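(* Let $n\ge 2$ agents communicate over an undirected connected weighted graph with Laplacian $L$. Let $f_1,\dots,f_n:\mathbb{R}^d\to\mathbb{R}$ be differentiable with $\|\nabla f_i(x)-\nabla f_i(y)\|\le L_f\|x-y\|$ for all $x,y\in\mathbb{R}^d$, $i\in[n]$, where $L_f>0$. Let $f=\frac1n\sum_{i=1}^n f_i$ and assume that $f^*=\min_{x\in\mathbb{R}^d}f(x)$ is finite. Let $\mathcal{C}:\mathbb{R}^d\to\mathbb{R}^d$ be a (possibly random) compressor such that, for some constants $\varphi\in(0,1]$ and $r>0$, $\mathbf{E}_{\mathcal C}\big[\|\mathcal{C}(x)/r-x\|^2\big]\le(1-\varphi)\|x\|^2$ for all $x\in\mathbb{R}^d$. Let $\{x_{i,k}\}$ be generated by Algorithm 2 (see context) with $\alpha=\kappa_1\beta$, $\beta>\kappa_2$, $\eta\in(0,\check\kappa_3)$, $\sigma\in(0,\kappa_0)$ and $\psi\in(0,1/r]$, where $\kappa_0,\kappa_1,\kappa_2,\check\kappa_3$ are the positive constants defined in the context. Let $\bar x_k=\frac1n\sum_{i=1}^n x_{i,k}$. Then, for any $T\in\mathbb{N}_0$, $$\sum_{k=0}^{T}\sum_{i=1}^{n}\mathbf{E}_{\mathcal{C}}\big[\|x_{i,k}-\bar{x}_k\|^2+\|\nabla f(\bar{x}_k)\|^2\big]=\mathcal{O}(1),\qquad \mathbf{E}_{\mathcal{C}}[f(\bar{x}_{T})-f^*]=\mathcal{O}(1),$$ where $\mathcal{O}(1)$ means bounded by a constant independent of $T$.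
   Context: Notation: $\mathbb{N}_0$ is the set of nonnegative integers, $[n]=\{1,\dots,n\}$, $\|\cdot\|$ is the Euclidean norm. The graph has symmetric weighted adjacency matrix $A=(a_{ij})$, $a_{ij}\ge0$, $a_{ii}=0$; $(i,j)$ is an edge iff $a_{ij}>0$; $L=(L_{ij})=\mathrm{diag}(\sum_j a_{1j},\dots,\sum_j a_{nj})-A$. $\rho(L)$ is the spectral radius of $L$ and $\rho_2(L)$ its smallest positive eigenvalue. $\mathbf{E}_{\mathcal C}$ is expectation over the internal randomness of the compressor; each application of $\mathcal C$ uses fresh randomness, so the compressor inequality holds conditionally on the past. Algorithm 2 (error feedback): positive parameters $\alpha,\beta,\eta,\psi,\sigma$. Initialize with arbitrary (deterministic) $x_{i,0}\in\mathbb{R}^d$, $a_{i,0}=b_{i,0}=e_{i,0}=v_{i,0}=\mathbf 0_d$, $q_{i,0}=\hat q_{i,0}=\mathcal C(x_{i,0})$. For $k=0,1,\dots$ and all $i\in[n]$: $a_{i,k+1}=a_{i,k}+\psi q_{i,k}$; $b_{i,k+1}=b_{i,k}+\psi\big(q_{i,k}-\sum_{j=1}^nL_{ij}q_{j,k}\big)$; $x_{i,k+1}=x_{i,k}-\eta\alpha\big(a_{i,k}-b_{i,k}+\sum_{j=1}^nL_{ij}\hat q_{j,k}\big)-\eta(\beta v_{i,k}+\nabla f_i(x_{i,k}))$; $v_{i,k+1}=v_{i,k}+\eta\beta\big(a_{i,k}-b_{i,k}+\sum_{j=1}^nL_{ij}\hat q_{j,k}\big)$; $q_{i,k+1}=\mathcal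 C(x_{i,k+1}-a_{i,k+1})$; $e_{i,k+1}=\sigma e_{i,k}+x_{i,k}-a_{i,k}-\hat q_{i,k}$; $\hat q_{i,k+1}=\mathcal C(\sigma e_{i,k+1}+x_{i,k+1}-a_{i,k+1})$. Constants: $r_0=2r^2(1-\varphi)+2(1-r)^2$; $r_1>1$ is any constant, $r_2=\frac{r_1}{r_1-1}$; $\kappa_0=\frac{1}{\sqrt{r_0r_1}}$. $\kappa_4>0$ is any constant; $\kappa_1$ is any constant with $\kappa_1\ge\max\{\frac{9+\kappa_4}{2\rho_2(L)},1\}$; $\kappa_5=\max\{\frac{4+5L_f^2}{\kappa_4},\frac{6}{\rho_2(L)}\}$; $\kappa_6=\frac{8(\kappa_1+1)^2L_f^2}{\kappa_5\rho_2(L)}+\frac{4L_f^2}{\rho_2^2(L)}$; $\kappa_2=\max\{\kappa_5,\sqrt{\kappa_6}\}$. $\epsilon_1=\frac{\alpha}{2}\rho_2(L)-\frac14(9\beta+4+5L_f^2)$, $\epsilon_2=3L_f^2+\frac{4(2+\varphi\psi r)}{\varphi\psi r}(\alpha^2\rho^2(L)+L_f^2)+2\beta^2+1+3\alpha^2\rho^2(L)$, $\epsilon_3=\frac{\beta}{2}-3\rho_2^{-1}(L)$, $\epsilon_4=2\beta^2\rho(L)+\frac{4(2+\varphi\psi r)\beta^2\rho^2(L)}{\varphi\psi r}+\rho_2^{-1}(L)$, $\epsilon_5=\frac18-\frac{(\alpha+\beta)^2L_f^2}{\beta^5\rho_2(L)}-\frac{L_f^2}{2\beta^2\rho_2^2(L)}$,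 $\epsilon_6=\frac{(\alpha+\beta)L_f^2}{2\beta^3\rho_2(L)}+\frac{3L_f^2}{4}+\frac{L_f^2}{2\beta^2\rho_2^2(L)}+\frac{L_f}{2}$, $\epsilon_7=\frac{\varphi\psi r}{2}(1+\varphi\psi r)$, $\epsilon_8=\frac12(\alpha+2\beta)\rho(L)r_0+2\beta r_0$, $\epsilon_9=\frac{(8+7\varphi\psi r)\alpha^2\rho^2(L)r_0}{\varphi\psi r}+(2\beta^2+1)r_0$, $\check\epsilon_8=((\alpha+2\beta)\rho(L)+4\beta)(r_0r_1+1)\sigma^2$, $\check\epsilon_9=2(7\alpha^2\rho^2(L)+2\beta^2+1)(r_0r_1+1)\sigma^2$. $\tau_0$ is any constant in $(0,\frac{\epsilon_7}{r_0r_2})$; $\tau_1=\frac{\sqrt{r_2^2\epsilon_8^2+2r_2\epsilon_9(\epsilon_7-r_0r_2\tau_0)}-r_2\epsilon_8}{2r_2\epsilon_9}$; $\tau_2=\frac{\sqrt{\check\epsilon_8^2+4(1-r_0r_1\sigma^2)\tau_0\check\epsilon_9}-\check\epsilon_8}{2\check\epsilon_9}$; $\check\kappa_3=\min\{\frac{\epsilon_1}{\epsilon_2},\frac{\epsilon_3}{\epsilon_4},\frac{\epsilon_5}{\epsilon_6},\tau_1,\tau_2\}$. In the degenerate case $r_0=0$ one reads $\kappa_0=\epsilon_7/(r_0r_2)=\tau_1=+\infty$. *)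

(* Defs.v *)
From HB Require Import structures.
From mathcomp Require Import all_boot all_order all_algebra.
From mathcomp Require Import all_classical all_reals all_analysis.

Set Implicit Arguments.
Unset Strict Implicit.
Unset Printing Implicit Defensive.

Import Order.TTheory GRing.Theory Num.Theory.
Import numFieldNormedType.Exports.

Local Open Scope classical_set_scope.
Local Open Scope ring_scope.

(* The library norm on row vectors is the max norm; it induces the same
   topology, hence the same differentials, as the Euclidean norm below. *)
Definition enorm (R : realType) (d : nat) (x : 'rV[R]_d) : R :=
  Num.sqrt (\sum_(j < d) x ord0 j ^+ 2).

Definition grad (R : realType) (d : nat) (f : 'rV[R]_d -> R) (x : 'rV[R]_d) :
  'rV[R]_d := \row_j 'D_(delta_mx ord0 j) f x.

Definition borelRd (R : realType) (d : nat) :=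
  g_sigma_algebraType (@open 'rV[R]_d).

Definition mean (R : realType) (n d : nat) (x : 'I_n -> 'rV[R]_d) : 'rV[R]_d :=
  n%:R^-1 *: \sum_(i < n) x i.

Definition avg (R : realType) (n d : nat) (f : 'I_n -> 'rV[R]_d -> R) :
  'rV[R]_d -> R := fun x => n%:R^-1 * \sum_(i < n) f i x.

Definition is_minimum (R : realType) (T : Type) (f : T -> R) (m : R) : Prop :=
  (exists x, f x = m) /\ (forall x, m <= f x).

Definition connected_weighted_graph (R : realType) (n : nat) (A : 'M[R]_n) :
  Prop :=
  [/\ forall i j, A i j = A j i,
      forall i j, 0 <= A i j,
      forall i, A i i = 0 &
      forall i j, connect (fun u v => 0 < A u v) i j].

Definition laplacian (R : realType) (n : nat) (A : 'M[R]_n) : 'M[R]_n :=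
  diag_mx (\row_i \sum_(j < n) A i j) - A.

(* Both definitions below are meant for symmetric matrices, all of whose
   complex eigenvalues are real; the sets are then finite, so that the
   supremum and the infimum are a maximum and a minimum whenever the sets
   are nonempty. *)
Definition spectral_radius (R : realType) (n : nat) (M : 'M[R]_n) : R :=
  sup [set `|a| | a in [set a | eigenvalue M a]].

Definition smallest_pos_eigenvalue (R : realType) (n : nat) (M : 'M[R]_n) : R :=
  inf [set a | eigenvalue M a /\ 0 < a].

(* A random compressor is a map C : W -> R^d -> R^d whose first argument is
   the internal random seed, drawn from the probability mu. *)
Definition compressor (R : realType) (d : nat) (dW : measure_display)
    (W : measurableType dW) (mu : probability W R)
    (C : W -> 'rV[R]_d -> 'rV[R]_d) (phi r : R) : Prop :=
  measurable_fun setT (fun p : W * borelRd R d => C p.1 p.2 : borelRd R d) /\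
  forall x : 'rV[R]_d,
    ('E_mu[fun w => (enorm (r^-1 *: C w x - x) ^+ 2)%R]
       <= ((1 - phi) * enorm x ^+ 2)%:E)%E.

Definition mutually_independent (R : realType) (dO dW : measure_display)
    (Omega : measurableType dO) (W : measurableType dW)
    (P : probability Omega R) (I : eqType) (X : I -> Omega -> W) : Prop :=
  forall (J : seq I) (B : I -> set W), uniq J -> (forall j, measurable (B j)) ->
    P (\big[setI/setT]_(j <- J) (X j @^-1` B j)) =
    (\prod_(j <- J) P (X j @^-1` B j))%E.

(* Fresh randomness: the seeds xi k i, used to compute q_{i,k}, and xih k i,
   used to compute hat q_{i,k}, form altogether an i.i.d. family of law mu. *)
Definition fresh_seeds (R : realType) (dO dW : measure_display)
    (Omega : measurableType dO) (W : measurableType dW)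
    (P : probability Omega R) (mu : probability W R) (n : nat)
    (xi xih : nat -> 'I_n -> Omega -> W) : Prop :=
  let seed (s : bool * (nat * 'I_n)) : Omega -> W :=
    if s.1 then xih s.2.1 s.2.2 else xi s.2.1 s.2.2 in
  [/\ forall s, measurable_fun setT (seed s),
      forall s (B : set W), measurable B -> P (seed s @^-1` B) = mu B &
      mutually_independent P seed].

(* A sample path of the algorithm, along the realised seeds xi k i (for q) and
   xih k i (for qh).  The initial q and qh share a single application of the
   compressor, so xih 0 is not used. *)
Record error_feedback_run (R : realType) (n d : nat) (W : Type)
    (C : W -> 'rV[R]_d -> 'rV[R]_d) (L : 'M[R]_n) (f : 'I_n -> 'rV[R]_d -> R)
    (alpha beta eta psi sigma : R) (x0 : 'I_n -> 'rV[R]_d)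
    (xi xih : nat -> 'I_n -> W)
    (a b x v q e qh : nat -> 'I_n -> 'rV[R]_d) : Prop := ErrorFeedbackRun {
  run_x0 : forall i, x 0%N i = x0 i ;
  run_a0 : forall i, a 0%N i = 0 ;
  run_b0 : forall i, b 0%N i = 0 ;
  run_e0 : forall i, e 0%N i = 0 ;
  run_v0 : forall i, v 0%N i = 0 ;
  run_q0 : forall i, q 0%N i = C (xi 0%N i) (x 0%N i) ;
  run_qh0 : forall i, qh 0%N i = q 0%N i ;
  run_a : forall k i, a k.+1 i = a k i + psi *: q k i ;
  run_b : forall k i,
    b k.+1 i = b k i + psi *: (q k i - \sum_(j < n) L i j *: q k j) ;
  run_x : forall k i,
    x k.+1 i = x k i
      - (eta * alpha) *: (a k i - b k i + \sum_(j < n) L i j *: qh k j)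
      - eta *: (beta *: v k i + grad (f i) (x k i)) ;
  run_v : forall k i,
    v k.+1 i = v k i
      + (eta * beta) *: (a k i - b k i + \sum_(j < n) L i j *: qh k j) ;
  run_q : forall k i, q k.+1 i = C (xi k.+1 i) (x k.+1 i - a k.+1 i) ;
  run_e : forall k i, e k.+1 i = sigma *: e k i + x k i - a k i - qh k i ;
  run_qh : forall k i,
    qh k.+1 i = C (xih k.+1 i) (sigma *: e k.+1 i + x k.+1 i - a k.+1 i)
}.

(* Here rho and rho2 stand for the spectral radius and the smallest positive
   eigenvalue of the Laplacian.  Constants that degenerate to +oo when
   cr0 = 0 are extended reals. *)
Section Constants.
Context (R : realType).
Implicit Types rho Lf phi r tau alpha beta psi sigma kappa : R.

Definition cr0 phi r : R := 2 * r ^+ 2 * (1 - phi) + 2 * (1 - r) ^+ 2.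

Definition cr2 r1 : R := r1 / (r1 - 1).

Definition kappa0 phi r r1 : \bar R :=
  if cr0 phi r == 0 then +oo%E else ((Num.sqrt (cr0 phi r * r1))^-1)%:E.

Definition kappa5 rho2 Lf kappa4 : R :=
  Num.max ((4 + 5 * Lf ^+ 2) / kappa4) (6 / rho2).

Definition kappa6 rho2 Lf kappa1 kappa4 : R :=
  8 * (kappa1 + 1) ^+ 2 * Lf ^+ 2 / (kappa5 rho2 Lf kappa4 * rho2)
  + 4 * Lf ^+ 2 / rho2 ^+ 2.

Definition kappa2 rho2 Lf kappa1 kappa4 : R :=
  Num.max (kappa5 rho2 Lf kappa4) (Num.sqrt (kappa6 rho2 Lf kappa1 kappa4)).

Definition eps1 rho2 Lf alpha beta : R :=
  alpha / 2 * rho2 - 1 / 4 * (9 * beta + 4 + 5 * Lf ^+ 2).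

Definition eps2 rho Lf phi r alpha beta psi : R :=
  3 * Lf ^+ 2
  + 4 * (2 + phi * psi * r) / (phi * psi * r)
      * (alpha ^+ 2 * rho ^+ 2 + Lf ^+ 2)
  + 2 * beta ^+ 2 + 1 + 3 * alpha ^+ 2 * rho ^+ 2.

Definition eps3 rho2 beta : R := beta / 2 - 3 * rho2^-1.

Definition eps4 rho rho2 phi r beta psi : R :=
  2 * beta ^+ 2 * rho
  + 4 * (2 + phi * psi * r) * beta ^+ 2 * rho ^+ 2 / (phi * psi * r)
  + rho2^-1.

Definition eps5 rho2 Lf alpha beta : R :=
  1 / 8 - (alpha + beta) ^+ 2 * Lf ^+ 2 / (beta ^+ 5 * rho2)
  - Lf ^+ 2 / (2 * beta ^+ 2 * rho2 ^+ 2).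

Definition eps6 rho2 Lf alpha beta : R :=
  (alpha + beta) * Lf ^+ 2 / (2 * beta ^+ 3 * rho2)
  + 3 * Lf ^+ 2 / 4
  + Lf ^+ 2 / (2 * beta ^+ 2 * rho2 ^+ 2)
  + Lf / 2.

Definition eps7 phi r psi : R :=
  phi * psi * r / 2 * (1 + phi * psi * r).

Definition eps8 rho phi r alpha beta : R :=
  1 / 2 * (alpha + 2 * beta) * rho * cr0 phi r + 2 * beta * cr0 phi r.

Definition eps9 rho phi r alpha beta psi : R :=
  (8 + 7 * phi * psi * r) * alpha ^+ 2 * rho ^+ 2 * cr0 phi r
    / (phi * psi * r)
  + (2 * beta ^+ 2 + 1) * cr0 phi r.

Definition check_eps8 rho phi r r1 alpha beta sigma : R :=
  ((alpha + 2 * beta) * rho + 4 * beta) * (cr0 phi r * r1 + 1) * sigma ^+ 2.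

Definition check_eps9 rho phi r r1 alpha beta sigma : R :=
  2 * (7 * alpha ^+ 2 * rho ^+ 2 + 2 * beta ^+ 2 + 1)
    * (cr0 phi r * r1 + 1) * sigma ^+ 2.

Definition tau0_bound phi r r1 psi : \bar R :=
  if cr0 phi r == 0 then +oo%E else (eps7 phi r psi / (cr0 phi r * cr2 r1))%:E.

Definition tau1 rho phi r r1 tau0 alpha beta psi : \bar R :=
  let e7 := eps7 phi r psi in
  let e8 := eps8 rho phi r alpha beta in
  let e9 := eps9 rho phi r alpha beta psi in
  if cr0 phi r == 0 then +oo%E else
  ((Num.sqrt (cr2 r1 ^+ 2 * e8 ^+ 2
              + 2 * cr2 r1 * e9 * (e7 - cr0 phi r * cr2 r1 * tau0))
    - cr2 r1 * e8) / (2 * cr2 r1 * e9))%:E.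

Definition tau2 rho phi r r1 tau0 alpha beta sigma : R :=
  let e8 := check_eps8 rho phi r r1 alpha beta sigma in
  let e9 := check_eps9 rho phi r r1 alpha beta sigma in
  (Num.sqrt (e8 ^+ 2 + 4 * (1 - cr0 phi r * r1 * sigma ^+ 2) * tau0 * e9) - e8)
    / (2 * e9).

Definition check_kappa3 rho rho2 Lf phi r r1 tau0 alpha beta psi sigma :
  \bar R :=
  Order.min (eps1 rho2 Lf alpha beta / eps2 rho Lf phi r alpha beta psi)%:E
  (Order.min (eps3 rho2 beta / eps4 rho rho2 phi r beta psi)%:E
  (Order.min (eps5 rho2 Lf alpha beta / eps6 rho2 Lf alpha beta)%:E
  (Order.min (tau1 rho phi r r1 tau0 alpha beta psi)
             (tau2 rho phi r r1 tau0 alpha beta sigma)%:E))).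

End Constants.

(* Main.v *)
Require Import Defs.
From HB Require Import structures.
From mathcomp Require Import all_boot all_order all_algebra.
From mathcomp Require Import complex.
From mathcomp Require Import all_classical all_reals all_analysis.
From mathcomp Require Import measurable_realfun.
From mathcomp Require Import ring lra.

Set Implicit Arguments.
Unset Strict Implicit.
Unset Printing Implicit Defensive.

Import Order.TTheory GRing.Theory Num.Theory.
Import numFieldNormedType.Exports.

Local Open Scope classical_set_scope.
Local Open Scope ring_scope.

(** Along a run a - b = L a, so the disagreement direction is L applied to the
    compressed iterate a + qh.  In an eigenbasis of L each nonzero mode is a
    perturbed two-dimensional linear system in the consensus error and in the
    dual error v + beta^-1 grad f_i (xbar), and it has a quadratic Lyapunov
    function.  Adding n (f (xbar) - fstar), the squared gap |x - a|^2 and tau0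
    times the squared error memory |e|^2 gives a potential whose expectation
    drops at each step by at least eta times a positive combination of the
    consensus error and of |grad f (xbar)|^2; telescoping this yields both
    bounds.  The compressor enters only through the expectations of the gap
    and of the memory, a fresh seed being independent of the sigma-algebra of
    the earlier ones.  The first two bounds on eta make the pathwise part of
    the descent work, and tau1 and tau2 keep the coefficients of the gap and
    of the memory below 1 and tau0. *)

(** * Measurability and independence *)

(** The coupling of the two error mechanisms dictates the shape of the estimates. The squared gap
    [x - a] shrinks in mean by [1 - s], where [s = phi * psi * r], but is pushed by the step
    [eta * h]; Young's inequality with weight [s / 2] charges [(1 + 2 / s) * eta ^ 2 * |h| ^ 2] for
    this, so the Lyapunov descent is stated with exactly that term held in reserve. The compression
    error seen by the dynamics is [e] at time [k + 1] minus [sigma] times [e] at time [k], so the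
    memory enters at two times and its weight [tau0] must absorb both. No moment of the iterates is
    known in advance. Expectations are therefore integrals of nonnegative functions that may be
    infinite, and finiteness comes only at the end, from the deterministic initial potential.
    Conditional expectations do not occur: a fresh seed and the earlier state have a product law,
    and Tonelli's theorem does the rest. Each compressor bound is applied to [q] or to [qh] alone,
    so nothing is asked of their joint law; this matters at time 0, where they coincide. *)

Lemma measurable_coord (R : realType) (d : nat) (j : 'I_d) :
  measurable_fun setT (fun x : borelRd R d => (x : 'rV[R]_d) ord0 j : R).
Proof.
apply: (measurability _ (RGenOpens.measurableE R)) => _ [_ [a [b ->] <-]].
rewrite setTI; apply: sub_sigma_algebra.
have /continuousP := @coord_continuous R 1 d ord0 j.
by apply; exact: interval_open.
Qed.

(** Brings vector-valued maps down to real coordinates, where the arithmetic of measurable functions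
    applies. *)
Lemma measurable_borelRdP (R : realType) (d : nat) (dT : measure_display)
    (T : measurableType dT) (g : T -> 'rV[R]_d) :
  measurable_fun setT (g : T -> borelRd R d) <->
  forall j, measurable_fun setT (fun t => g t ord0 j).
Proof.
split=> [mg j|mg].
  exact: (measurableT_comp (@measurable_coord R d j) mg).
apply: (@measurability _ _ T (borelRd R d) setT g (@open _) erefl).
move=> _ [A oA <-]; rewrite setTI.
(* An open set is a countable union of rational boxes. *)
pose box (cq : {ffun 'I_d -> rat} * rat) : set 'rV[R]_d :=
  [set x | forall j, `|ratr (cq.1 j) - x ord0 j| < ratr cq.2].
pose sub (cq : {ffun 'I_d -> rat} * rat) : set 'rV[R]_d :=
  if `[< box cq `<=` A >] then box cq else set0.
have -> : A = \bigcup_cq sub cq.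
  apply/seteqP; split=> [x Ax|x [cq _]]; last first.
    by rewrite /sub; case: asboolP => // sA /sA.
  have [e /= e0 eA] : exists2 e : R, 0 < e & ball x e `<=` A.
    by move: (oA _ Ax) => /nbhs_ballP [e e0 eA]; exists e.
  (* Half of the radius: a box of radius [q] whose centre is within [q] of [x] stays within
     [2 * q < e] of [x]. *)
  have [q q0 qe] : exists2 q : rat, 0 < ratr q :> R & ratr q < e / 2 :> R.
    have [q] := @rat_in_itvoo R 0 (e / 2) ltac:(by rewrite divr_gt0).
    by rewrite in_itv /= => /andP[]; exists q.
  have cj j : exists c : rat, `|ratr c - x ord0 j| < ratr q.
    have [c] := @rat_in_itvoo R (x ord0 j - ratr q) (x ord0 j + ratr q)
      ltac:(by rewrite ltrD2l gt0_cp).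
    by rewrite in_itv /= => /andP[c1 c2]; exists c; rewrite ltr_distl c1.
  pose c := [ffun j => projT1 (cid (cj j))].
  exists (c, q) => //; rewrite /sub.
  have cx : box (c, q) x by move=> j /=; rewrite ffunE; case: cid.
  case: asboolP => // -[] y cy; apply: eA; split=> // i j.
  rewrite (ord1 i) /ball /= (le_lt_trans (ler_distD (ratr (c j)) _ _)) //.
  rewrite (splitr e) ltrD //; apply: lt_trans qe; last exact: cy.
  by rewrite distrC; exact: cx.
rewrite preimage_bigcup; apply: countable_bigcupT_measurable => // cq.
rewrite /sub; case: ifP => _; last by rewrite preimage_set0.
have -> : g @^-1` box cq =
    \bigcap_(j in [set: 'I_d]) [set t | `|ratr (cq.1 j) - g t ord0 j| < ratr cq.2].
  by apply/seteqP; split=> t; [move=> h j _; exact: h|move=> h j; exact: h].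
apply: fin_bigcap_measurable => // j _.
have : measurable_fun setT (fun t => `|ratr (cq.1 j) - g t ord0 j|).
  by apply: measurableT_comp => //; exact: measurable_funB.
move=> /(_ measurableT `]-oo, ratr cq.2[%classic (measurable_itv _)).
by rewrite setTI preimage_itvNyo.
Qed.

(** * Sigma-algebras generated by part of a family of seeds *)

Section Cylinders.
Context (dO dW : measure_display) (Omega : measurableType dO)
  (W : measurableType dW) (I : choiceType).
Implicit Types (X : I -> Omega -> W) (p : pred I).

(** The list [J] may repeat indices, so that concatenation gives closure under intersection;
    [cylinderE] removes the repetitions where mutual independence asks for a [uniq] list. *)
Definition cylinders X p : set (set Omega) :=
  [set A | exists (J : seq I) (B : I -> set W),
    [/\ all p J, forall j, measurable (B j) &
        A = [set w | forall j, j \in J -> B j (X j w)]]].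

(** A copy of [Omega] carrying the sigma-algebra of the seeds selected by [p], so that measurability
    with respect to the past is ordinary measurability on this type. *)
Definition sub_sigma X p := g_sigma_algebraType (cylinders X p).

Lemma cylinders_setI_closed X p : setI_closed (cylinders X p).
Proof.
move=> _ _ [J1 [B1 [p1 m1 ->]]] [J2 [B2 [p2 m2 ->]]].
exists (J1 ++ J2), (fun j => (if j \in J1 then B1 j else setT) `&`
                             (if j \in J2 then B2 j else setT)).
split; first by rewrite all_cat p1.
  by move=> j; apply: measurableI; case: ifP.
apply/seteqP; split=> w /=.
  move=> [h1 h2] j; rewrite mem_cat => _.
  by split; case: ifP => // jJ; [exact: h1|exact: h2].
move=> h; split=> j jJ.
  by have := h j; rewrite mem_cat jJ => /(_ isT) [].
by have := h j; rewrite mem_cat jJ orbT => /(_ isT) [].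
Qed.

Lemma cylinder_preimage X p i (B : set W) : p i -> measurable B ->
  cylinders X p (X i @^-1` B).
Proof.
move=> pi mB; exists [:: i], (fun=> B); split=> //=; first by rewrite pi.
apply/seteqP; split=> w /= h; last by apply: h; rewrite inE.
by move=> j; rewrite inE => /eqP ->.
Qed.

Lemma cylinders_setT X p : cylinders X p setT.
Proof.
by exists [::], (fun=> setT); split=> //; apply/seteqP; split.
Qed.

Lemma cylinderE (J : seq I) (B : I -> set W) X :
  [set w | forall j, j \in J -> B j (X j w)] =
  \big[setI/setT]_(j <- undup J) (X j @^-1` B j).
Proof.
rewrite -bigcap_seq; apply/seteqP; split=> w h j /=.
  by rewrite mem_undup; exact: h.
by move=> jJ; apply: h; rewrite /= mem_undup.
Qed.

Lemma cylinders_measurable X p : (forall i, measurable_fun setT (X i)) ->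
  cylinders X p `<=` measurable.
Proof.
move=> mX _ [J [B [_ mB ->]]]; rewrite cylinderE.
apply: bigsetI_measurable => j _.
by rewrite -[X in measurable X]setTI; exact: mX.
Qed.

Lemma sub_sigma_measurable X p : (forall i, measurable_fun setT (X i)) ->
  <<s cylinders X p >> `<=` measurable.
Proof.
move=> mX; apply: smallest_sub; first exact: sigma_algebra_measurable.
exact: cylinders_measurable.
Qed.

Lemma measurable_sub_sigma_gen X p i : p i ->
  measurable_fun setT (X i : sub_sigma X p -> W).
Proof.
move=> pi _ B mB; rewrite setTI; apply: sub_sigma_algebra.
exact: cylinder_preimage.
Qed.

Lemma cylinders_mono X p p' : {subset p <= p'} ->
  cylinders X p `<=` cylinders X p'.
Proof.
move=> pp' _ [J [B [pJ mB ->]]]; exists J, B; split=> //.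
by apply: sub_all pJ => j; exact: pp'.
Qed.

Lemma measurable_sub_sigma_mono X p p' (d' : measure_display)
    (T : measurableType d') (g : Omega -> T) : {subset p <= p'} ->
  measurable_fun setT (g : sub_sigma X p -> T) ->
  measurable_fun setT (g : sub_sigma X p' -> T).
Proof.
move=> pp' mg _ B mB; have := mg measurableT B mB.
by apply: sub_smallest2r; [exact: smallest_sigma_algebra|exact: cylinders_mono].
Qed.

Lemma measurable_sub_sigma_full X p (d' : measure_display)
    (T : measurableType d') (g : Omega -> T) :
  (forall i, measurable_fun setT (X i)) ->
  measurable_fun setT (g : sub_sigma X p -> T) -> measurable_fun setT g.
Proof.
move=> mX mg _ B mB; have := mg measurableT B mB.
exact: sub_sigma_measurable.
Qed.

(** Uniqueness of measures on a pi-system: with [B] fixed, [P] restricted to the event that [X i]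
    falls in [B] and [P] scaled by the probability of that event agree on cylinders, hence on the
    sigma-algebra they generate. *)
Lemma sub_sigma_indep (R : realType) (P : probability Omega R) X p i
    (A : set Omega) (B : set W) :
  (forall i, measurable_fun setT (X i)) -> mutually_independent P X ->
  <<s cylinders X p >> A -> ~~ p i -> measurable B ->
  P (A `&` X i @^-1` B) = (P A * P (X i @^-1` B))%E.
Proof.
move=> mX iX sA npi mB.
have mXB : measurable (X i @^-1` B).
  by rewrite -[X in measurable X]setTI; exact: mX.
have PB0 : (0 <= fine (P (X i @^-1` B)))%R by rewrite fine_ge0.
have scaleE A' : mscale (NngNum PB0) P A' = (P A' * P (X i @^-1` B))%E.
  by rewrite /mscale /= fineK ?fin_num_measure // muleC.
rewrite -scaleE -[LHS]/(mrestr P mXB A).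
apply: (@g_sigma_algebra_measure_unique _ _ _ (cylinders X p) _ (fun=> setT))
  => //.
- exact: cylinders_measurable.
- by move=> _; exact: cylinders_setT.
- by rewrite bigcup_const //; exists 0%N.
- exact: cylinders_setI_closed.
- move=> _ [J [B' [pJ mB' ->]]]; rewrite cylinderE.
  apply: etrans (esym (scaleE _)).
  rewrite -[LHS]/(P (_ `&` X i @^-1` B)).
  have iJ : i \notin undup J.
    by rewrite mem_undup; apply: contraNN npi => iJ; rewrite (allP pJ).
  (* The event on [X i] becomes one more coordinate of the cylinder; it clashes with no other, as
     [i] is not in [J]. *)
  pose B2 j := if j == i then B else B' j.
  have B2E : \big[setI/setT]_(j <- undup J) (X j @^-1` B' j) =
             \big[setI/setT]_(j <- undup J) (X j @^-1` B2 j).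
    rewrite !big_seq; apply: eq_bigr => j jJ; rewrite /B2.
    by case: eqP => // ji; rewrite -ji jJ in iJ.
  have mB2 j : measurable (B2 j) by rewrite /B2; case: ifP.
  have -> : X i @^-1` B = X i @^-1` B2 i by rewrite /B2 eqxx.
  rewrite B2E setIC; have := iX (i :: undup J) B2.
  rewrite /= iJ undup_uniq !big_cons => -> //.
  by rewrite iX ?undup_uniq // muleC.
- by move=> k; rewrite -[X in (X < _)%E]/(P (setT `&` _)) setTI ltey_eq
    fin_num_measure.
Qed.

End Cylinders.

Lemma enorm_sqE (R : realType) (d : nat) (x : 'rV[R]_d) :
  enorm x ^+ 2 = \sum_j x ord0 j ^+ 2.
Proof. by rewrite sqr_sqrtr // sumr_ge0 // => j _; exact: sqr_ge0. Qed.

Lemma measurable_enorm_sq (R : realType) (d : nat) (dT : measure_display)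
    (T : measurableType dT) (g : T -> 'rV[R]_d) :
  measurable_fun setT (g : T -> borelRd R d) ->
  measurable_fun setT (fun t => enorm (g t) ^+ 2).
Proof.
move=> /measurable_borelRdP mg; under eq_fun do rewrite enorm_sqE.
by apply: measurable_sum => j; apply: measurable_funX; exact: mg.
Qed.

(** Takes the place of conditioning on [Y]: independence makes the law of the pair a product
    measure, and Tonelli's theorem integrates the seed first. Nonnegativity of [f] spares any
    integrability condition. *)
Lemma ge0_integral_indep (R : realType) (d d1 d2 : measure_display)
    (Omega : measurableType d) (T1 : measurableType d1)
    (T2 : measurableType d2) (P : probability Omega R)
    (mu : probability T1 R) (X : Omega -> T1) (Y : Omega -> T2)
    (f : T1 * T2 -> \bar R) :
  measurable_fun setT X -> measurable_fun setT Y ->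
  (forall A B, measurable A -> measurable B ->
     P (X @^-1` A `&` Y @^-1` B) = (mu A * P (Y @^-1` B))%E) ->
  measurable_fun setT f -> (forall z, (0 <= f z)%E) ->
  (\int[P]_w f (X w, Y w) = \int[P]_w \int[mu]_s f (s, Y w))%E.
Proof.
move=> mX mY indep mf f0.
pose Yr : {mfun Omega >-> T2} := HB.pack Y (isMeasurableFun.Build _ _ _ _ _ mY).
have mXY : measurable_fun setT (fun w => (X w, Y w)) by exact: measurable_fun_pair.
pose XYr : {mfun Omega >-> (T1 * T2)%type} :=
  HB.pack (fun w => (X w, Y w)) (isMeasurableFun.Build _ _ _ _ _ mXY).
transitivity (\int[distribution P XYr]_z f z)%E.
  by rewrite ge0_integral_distribution.
transitivity (\int[mu \x distribution P Yr]_z f z)%E.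
  apply: eq_measure_integral => A mA _; apply/esym.
  exact: (@product_measure_unique _ _ _ _ _ mu (distribution P Yr)
    (distribution P XYr)).
rewrite fubini_tonelli2 // ge0_integral_distribution //.
  exact: measurable_fun_fubini_tonelli_G.
by move=> y; exact: integral_ge0.
Qed.

(** The compressor inequality is given at fixed points only; integrating the seed with the input
    frozen lets it be applied at the random point [Y w]. *)
Lemma compressor_integral_le (R : realType) (d : nat) (dO dW : measure_display)
    (Omega : measurableType dO) (W : measurableType dW)
    (P : probability Omega R) (mu : probability W R)
    (C : W -> 'rV[R]_d -> 'rV[R]_d) (phi r : R) (X : Omega -> W)
    (Y : Omega -> 'rV[R]_d) :
  phi <= 1 -> compressor mu C phi r ->
  measurable_fun setT X -> measurable_fun setT (Y : Omega -> borelRd R d) ->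
  (forall (A : set W) (B : set (borelRd R d)), measurable A -> measurable B ->
     P (X @^-1` A `&` Y @^-1` B) = (mu A * P (Y @^-1` B))%E) ->
  (\int[P]_w (enorm (r^-1 *: C (X w) (Y w) - Y w) ^+ 2)%:E
    <= (1 - phi)%:E * \int[P]_w (enorm (Y w) ^+ 2)%:E)%E.
Proof.
move=> phi1 [mC HC] mX mY indep.
pose f (z : W * borelRd R d) : \bar R :=
  (enorm (r^-1 *: C z.1 z.2 - (z.2 : 'rV[R]_d)) ^+ 2)%:E.
have mf : measurable_fun setT f.
  apply/measurable_EFinP; apply: measurable_enorm_sq.
  apply/measurable_borelRdP => j.
  under eq_fun do rewrite !mxE.
  apply: measurable_funB; last exact: measurableT_comp (@measurable_coord R d j) _.
  apply: measurable_funM => //.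
  exact: (measurableT_comp (@measurable_coord R d j) mC).
have f0 z : (0 <= f z)%E by rewrite lee_fin sqr_ge0.
rewrite (@ge0_integral_indep _ _ _ _ _ _ (borelRd R d) P mu X Y f) //.
rewrite -ge0_integralZl //; first last.
- by rewrite lee_fin subr_ge0.
- by move=> w _; rewrite lee_fin sqr_ge0.
- by apply/measurable_EFinP; exact: measurable_enorm_sq.
apply: ge0_le_integral => //.
- by move=> w _; apply: integral_ge0 => s _; rewrite lee_fin sqr_ge0.
- have mG : measurable_fun setT (fubini_G mu f).
    exact: measurable_fun_fubini_tonelli_G.
  exact: (measurableT_comp mG mY).
- apply/measurable_EFinP; apply: measurable_funM => //.
  exact: measurable_enorm_sq.
- by move=> w _; have := HC (Y w); rewrite unlock -EFinM.
Qed.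

(** * The dynamics of one mode *)

(** The cross term [x * y] supplies a damping of [y] that the dual recursion alone lacks. Along the
    linear flow [x' = - (a x + b y)], [y' = be x], the products [x y] in the derivative cancel for
    [c = (a + b) / be], which is the value [k * b] used below. *)
Definition mode_energy (R : realFieldType) (c x y : R) : R :=
  x ^+ 2 / 2 + c / 2 * y ^+ 2 + x * y.

Lemma mode_energy_ge0 (R : realFieldType) (c x y : R) :
  1 <= c -> 0 <= mode_energy c x y.
Proof.
move=> c1; have -> : mode_energy c x y = (x + y) ^+ 2 / 2 + (c - 1) / 2 * y ^+ 2.
  by rewrite /mode_energy; field.
by rewrite addr_ge0 // mulr_ge0 ?divr_ge0 ?sqr_ge0 ?subr_ge0.
Qed.

(* One step of the dynamics restricted to an eigenvector of the Laplacian with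
   eigenvalue lam: a = alpha * lam, b = beta * lam, k = (alpha + beta) / beta ^ 2,
   x is the consensus error, xh its compressed version x - dl, y the dual error
   divided by lam, p the gradient error and eta * g the drift of the
   dual equilibrium. *)
Lemma mode_descent (R : realFieldType) (eta z a b be k x dl y p g : R) :
  0 < eta -> 0 < b -> 0 < be -> 1 <= z ->
  a + b = k * be * b -> b <= a -> 9 / 2 * be <= a ->
  eta * be <= 1 / 100 -> eta <= 1 / 100 ->
  eta * a * (8 * z + 7) <= 1 / 2 ->
  eta * (6 + 6 * z) * b ^+ 2 <= b / 2 - 1 ->
  forall h : R, h = a * (x - dl) + b * y + p ->
  mode_energy (k * b) (x - eta * h) (y + eta * (be * (x - dl) + g))
    + (1 + 2 * z) * eta ^+ 2 * h ^+ 2 <=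
  mode_energy (k * b) x y
    + eta * (- (a / 2 - 9 / 8 * be - 1) * x ^+ 2
             + (a / 2 + b + 2 * be) * dl ^+ 2
             + (3 / 4 + eta * (6 + 6 * z)) * p ^+ 2
             + (1 + 2 * k ^+ 2 * b) * g ^+ 2).
Proof.
move=> eta0 b0 be0 z1 abE ba bea H2 H5 H3 H4 h; set xh := x - dl => hE.
have a0 : 0 < a by apply: lt_le_trans ba.
have kbe : 2 <= k * be.
  by rewrite -(ler_pM2r b0) -abE; lra.
have k0 : 0 < k by rewrite -(pmulr_lgt0 _ be0); lra.
have keta : 200 * eta <= k.
  by rewrite -(ler_pM2r be0); lra.
(* Squares that certify the descent: [I2] to [I7] are Young inequalities for the cross terms with
   [dl], [p] and [g]; [I8] and [I9] serve the terms of second order in [eta]. *)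
have I2 : 0 <= b * (y / 2 + dl) ^+ 2 by rewrite mulr_ge0 ?sqr_ge0 // ltW.
have I3 : 0 <= be * (x / 2 + 2 * dl) ^+ 2 by rewrite mulr_ge0 ?sqr_ge0 // ltW.
have I4 := sqr_ge0 (x + p).
have I5 := sqr_ge0 (y + p / 2).
have I6 := sqr_ge0 (x - g).
have I7 : 0 <= b * (y / 2 - k * g) ^+ 2 by rewrite mulr_ge0 ?sqr_ge0 // ltW.
have I8 : 0 <= eta * (h + (be * xh + g)) ^+ 2 by rewrite mulr_ge0 ?sqr_ge0 // ltW.
have I9 : 0 <= eta * (1 + k * b) * (be * xh - g) ^+ 2.
  by rewrite mulr_ge0 ?sqr_ge0 // mulr_ge0 ?addr_ge0 ?mulr_ge0 // ltW.
(* The weight [2 + 2 * z] is the reserve [1 + 2 * z] plus two halves, one from the square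
   [x ^+ 2 / 2] in the energy and one from [I8]. *)
have h2 : 0 <= eta * (2 + 2 * z) *
    (3 * ((a * xh) ^+ 2 + (b * y) ^+ 2 + p ^+ 2) - h ^+ 2).
  rewrite mulr_ge0 //; first by rewrite mulr_ge0 ?(ltW eta0) //; lra.
  have -> : 3 * ((a * xh) ^+ 2 + (b * y) ^+ 2 + p ^+ 2) - h ^+ 2 =
    (a * xh - b * y) ^+ 2 + (a * xh - p) ^+ 2 + (b * y - p) ^+ 2.
    by rewrite hE; ring.
  by rewrite !addr_ge0 ?sqr_ge0.
(* [Cy], [Cx] and [Cg] hold what is left of the coefficients of [y], [xh] and [g]; the smallness of
   [eta] makes each nonnegative. *)
have Cy : 0 <= (b / 2 - 1 - eta * (6 + 6 * z) * b ^+ 2) * y ^+ 2.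
  by rewrite mulr_ge0 ?sqr_ge0 // subr_ge0.
have Cx : 0 <= (a / 2 - eta * (6 + 6 * z) * a ^+ 2
                - eta * (1 + k * b) * be ^+ 2) * xh ^+ 2.
  rewrite mulr_ge0 ?sqr_ge0 //.
  have E1 : 0 <= a * (4 / 5 * (1 / 2 - eta * a * (8 * z + 7))).
    by rewrite mulr_ge0 ?(ltW a0) //; lra.
  have E2 : 0 <= eta * a ^+ 2 * (z - 1).
    by apply: mulr_ge0; [rewrite mulr_ge0 ?sqr_ge0 ?ltW|rewrite subr_ge0].
  have E3 : 0 <= be * (1 / 100 - eta * be) by rewrite mulr_ge0 ?(ltW be0) ?subr_ge0.
  have E4 : 0 <= (a + b) * (1 / 100 - eta * be).
    by apply: mulr_ge0; [rewrite addr_ge0 ?ltW|rewrite subr_ge0].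
  have E5 : eta * (1 + k * b) * be ^+ 2 = eta * be * be + eta * be * (a + b).
    by rewrite abE; ring.
  by rewrite E5; lra.
have Cg : 0 <= (1 / 2 + k ^+ 2 * b - eta * (1 + k * b)) * g ^+ 2.
  rewrite mulr_ge0 ?sqr_ge0 //.
  have : 0 <= k * b * (k - 200 * eta).
    by apply: mulr_ge0; [rewrite mulr_ge0 ?ltW|rewrite subr_ge0].
  have : 0 <= k * b * k by rewrite !mulr_ge0 // ltW.
  by lra.
rewrite -subr_ge0.
set D := (X in 0 <= X).
(* The whole difference carries a factor [eta]; divided by it, it becomes the combination of the
   above squares in [DE]. *)
have -> : D = eta * (D / eta) by rewrite mulrCA divff ?mulr1 // gt_eqF.
apply: mulr_ge0; first exact: ltW.
have DE : D / eta = b * (y / 2 + dl) ^+ 2 + be * (x / 2 + 2 * dl) ^+ 2 / 2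
  + (x + p) ^+ 2 / 2 + (y + p / 2) ^+ 2 + (x - g) ^+ 2 / 2
  + b * (y / 2 - k * g) ^+ 2 + eta * (h + (be * xh + g)) ^+ 2 / 2
  + eta * (1 + k * b) * (be * xh - g) ^+ 2 / 2
  + eta * (2 + 2 * z) *
    (3 * ((a * xh) ^+ 2 + (b * y) ^+ 2 + p ^+ 2) - h ^+ 2)
  + (b / 2 - 1 - eta * (6 + 6 * z) * b ^+ 2) * y ^+ 2
  + (a / 2 - eta * (6 + 6 * z) * a ^+ 2
                - eta * (1 + k * b) * be ^+ 2) * xh ^+ 2
  + (1 / 2 + k ^+ 2 * b - eta * (1 + k * b)) * g ^+ 2.
  have aE : a = k * be * b - b by rewrite -abE addrK.
  rewrite /D /mode_energy hE /xh aE; field; exact: lt0r_neq0.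
by rewrite DE; lra.
Qed.


(** * Spectrum of the Laplacian *)

(* The rows of Q are the real and imaginary parts of a unitary eigenbasis over
   R[i], so that the spectrum is listed twice. *)
Lemma symmetric_spectral (R : realType) (n : nat) (L : 'M[R]_n) : L^T = L ->
  exists (Q : 'M[R]_(n + n, n)) (lam : 'I_(n + n) -> R),
    (forall l j, \sum_i Q l i * L i j = lam l * Q l j) /\
    (forall z : 'I_n -> R, \sum_l (\sum_i Q l i * z i) ^+ 2 = \sum_i z i ^+ 2).
Proof.
move=> symL.
pose LC : 'M[R[i]%C]_n := map_mx (real_complex R) L.
have hL : LC \is hermsymmx.
  apply/is_hermitianmxP; rewrite expr0 scale1r; apply/matrixP=> i j.
  by rewrite !mxE -[in LHS]symL mxE; exact/esym/conjc_real.
pose U := spectralmx LC; pose D := spectral_diag LC.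
(* The eigenvalues of a Hermitian matrix are real, so the real and imaginary parts of an eigenvector
   of the real matrix [L] satisfy the eigenvector equation separately; either part may vanish. *)
have Dreal l : D 0 l = (complex.Re (D 0 l))%:C%C.
  apply/esym/RRe_real.
  by have /mxOverP := hermitian_spectral_diag_real hL; exact.
have UL : U *m LC = diag_mx D *m U.
  have /hermitian_normalmx /orthomx_spectralP E := hL.
  by rewrite {1}E -mulmxA mulKVmx ?spectral_unit.
have eig l j : \sum_i U l i * (L i j)%:C%C = (complex.Re (D 0 l))%:C%C * U l j.
  have /matrixP/(_ l j) := UL; rewrite mul_diag_mx !mxE -Dreal => <-.
  by apply: eq_bigr => i _; rewrite !mxE.
pose Q : 'M[R]_(n + n, n) := \matrix_(l, i)
  match fintype.split l with
  | inl l => complex.Re (U l i) | inr l => complex.Im (U l i)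
  end.
exists Q, (fun l =>
  match fintype.split l with inl l | inr l => complex.Re (D 0 l) end).
have Sl l i : Q (lshift n l) i = complex.Re (U l i).
  by rewrite mxE (unsplitK (inl l)).
have Sr l i : Q (rshift n l) i = complex.Im (U l i).
  by rewrite mxE (unsplitK (inr l)).
have ReS (I : finType) (F : I -> R[i]%C) :
    complex.Re (\sum_i F i) = \sum_i complex.Re (F i).
  exact: (raddf_sum (@complex.Re R : Rcomplex R -> R)).
have ImS (I : finType) (F : I -> R[i]%C) :
    complex.Im (\sum_i F i) = \sum_i complex.Im (F i).
  exact: (raddf_sum (@complex.Im R : Rcomplex R -> R)).
have ReM (u : R[i]%C) (t : R) : complex.Re (u * t%:C%C) = complex.Re u * t.
  by case: u => x y /=; rewrite mulr0 subr0.
have ImM (u : R[i]%C) (t : R) : complex.Im (u * t%:C%C) = complex.Im u * t.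
  by case: u => x y /=; rewrite mulr0 add0r.
split=> [l j|z].
  rewrite -(splitK l); case: (fintype.split l) => {}l; rewrite unsplitK /=.
    under eq_bigr do rewrite Sl -ReM; rewrite -ReS eig Sl mulrC ReM.
    by rewrite mulrC.
  under eq_bigr do rewrite Sr -ImM; rewrite -ImS eig Sr mulrC ImM.
  by rewrite mulrC.
rewrite big_split_ord /= -big_split /=.
pose zc : 'cV[R[i]%C]_n := \col_i (z i)%:C%C.
(* [U] is unitary and preserves the norm of [z]; the squared modulus of each entry of [U z] then
   splits into the squares of its two parts. *)
have zE : ((U *m zc)^t* *m (U *m zc) = zc^t* *m zc)%sesqui.
  rewrite trmx_mul map_mxM -mulmxA (mulmxA _ U).
  have /unitarymxP/mulmx1C -> := spectral_unitarymx LC.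
  by rewrite mul1mx.
apply: (@complexI R); rewrite !rmorph_sum /=.
have /matrixP/(_ 0 0) := zE; rewrite !mxE => zE0.
transitivity (\sum_j ((U *m zc)^t*)%sesqui 0 j * (U *m zc) j 0).
  apply: eq_bigr => l _.
  under eq_bigr do rewrite Sl -ReM; rewrite -ReS.
  under [in X in _ + X]eq_bigr do rewrite Sr -ImM; rewrite -ImS.
  rewrite [in LHS]add_Re2_Im2 normCK mulrC !mxE.
  by congr (_^* * _); apply: eq_bigr => i _; rewrite !mxE.
rewrite zE0; apply: eq_bigr => i _; rewrite !mxE.
by rewrite [X in X * _]conjc_real rmorphXn /= expr2.
Qed.

Section Laplacian.
Context (R : realType) (n : nat) (A : 'M[R]_n).
Hypothesis graphA : connected_weighted_graph A.

Lemma laplacianE i j :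
  laplacian A i j = (\sum_k A i k) *+ (i == j) - A i j.
Proof. by rewrite !mxE. Qed.

Lemma laplacian_sym : (laplacian A)^T = laplacian A.
Proof.
have [symA _ _ _] := graphA; apply/matrixP=> i j; rewrite mxE !laplacianE.
by rewrite symA eq_sym; case: eqP => // ->.
Qed.

Lemma laplacian_row_sum i : \sum_j laplacian A i j = 0.
Proof.
under eq_bigr do rewrite laplacianE; rewrite sumrB (bigD1 i) //= eqxx.
rewrite [X in _ + X - _]big1.
  by rewrite addr0 subrr.
by move=> j; rewrite eq_sym => /negbTE ->.
Qed.

(** The Dirichlet form of the graph; the factor 2 counts each edge in both directions. *)
Lemma laplacian_quadratic (v : 'I_n -> R) :
  2 * \sum_j (\sum_i v i * laplacian A i j) * v j =
  \sum_i \sum_j A i j * (v i - v j) ^+ 2.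
Proof.
have [symA _ _ _] := graphA.
have E1 j : \sum_i v i * laplacian A i j =
    v j * (\sum_k A j k) - \sum_i v i * A i j.
  under eq_bigr do rewrite laplacianE mulrBr; rewrite sumrB; congr (_ - _).
  rewrite (bigD1 j) //= eqxx mulr1n [X in _ + X]big1 ?addr0 // => i /negbTE ->.
  by rewrite mulr0n mulr0.
have E2 : \sum_i \sum_j A i j * v i ^+ 2 = \sum_i \sum_j A i j * v j ^+ 2.
  rewrite exchange_big /=; apply: eq_bigr => i _; apply: eq_bigr => j _.
  by rewrite symA.
transitivity (\sum_i \sum_j A i j * v i ^+ 2 + \sum_i \sum_j A i j * v j ^+ 2
    - 2 * \sum_i \sum_j A i j * (v i * v j)).
  rewrite -E2 -mulr2n -(mulr_natl (\sum_i _)) -mulrBr; congr (_ * _).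
  rewrite -sumrB; apply: eq_bigr => j _; rewrite E1 mulrBl; congr (_ - _).
    by rewrite mulrAC -expr2 mulr_sumr; apply: eq_bigr => k _; rewrite mulrC.
  by rewrite mulr_suml; apply: eq_bigr => i _; rewrite symA; ring.
rewrite mulr_sumr -big_split -sumrB /=; apply: eq_bigr => i _.
rewrite mulr_sumr -big_split -sumrB /=; apply: eq_bigr => j _.
by ring.
Qed.

Lemma laplacian_eigenvalue_ge0 (lam : R) (v : 'I_n -> R) :
  (forall j, \sum_i v i * laplacian A i j = lam * v j) ->
  (exists j, v j != 0) -> 0 <= lam.
Proof.
move=> eig [j vj0]; have [_ A0 _ _] := graphA.
have : 0 <= 2 * \sum_j (\sum_i v i * laplacian A i j) * v j.
  rewrite laplacian_quadratic; apply: sumr_ge0 => i _; apply: sumr_ge0 => k _.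
  by rewrite mulr_ge0 ?sqr_ge0.
under eq_bigr do rewrite eig -mulrA -expr2.
rewrite -mulr_sumr pmulr_rge0 // pmulr_lge0 //.
rewrite (bigD1 j) //= ltr_wpDr ?exprn_even_gt0 //.
by apply: sumr_ge0 => k _; exact: sqr_ge0.
Qed.

(** Zero Dirichlet energy forces equal values across each edge, and paths spread the equality over
    the connected graph. *)
Lemma laplacian_kernel_constant (v : 'I_n -> R) :
  (forall j, \sum_i v i * laplacian A i j = 0) -> forall i j, v i = v j.
Proof.
move=> ker; have [_ A0 _ conn] := graphA.
have S0 : \sum_i \sum_j A i j * (v i - v j) ^+ 2 = 0.
  by rewrite -laplacian_quadratic big1 ?mulr0 // => j _; rewrite ker mul0r.
have edge i j : 0 < A i j -> v i = v j.
  move=> Aij; have T0 k l : 0 <= A k l * (v k - v l) ^+ 2.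
    by rewrite mulr_ge0 ?sqr_ge0.
  have /eqP := S0; rewrite psumr_eq0; last by move=> k _; rewrite sumr_ge0.
  move=> /allP /(_ i (mem_index_enum i)) /=; rewrite psumr_eq0 //.
  move=> /allP /(_ j (mem_index_enum j)) /=.
  by rewrite mulf_eq0 (gt_eqF Aij) /= sqrf_eq0 subr_eq0 => /eqP.
move=> i j; have /connectP [p] := conn i j.
elim: p i => [|k p IH] i /=; first by move=> _ ->.
by move=> /andP[/edge -> pp] jE; exact: IH.
Qed.

(** Rows of the Laplacian sum to zero, so eigenvectors of nonzero eigenvalue are orthogonal to the
    constants. *)
Lemma laplacian_image_sum (lam : R) (v : 'I_n -> R) :
  (forall j, \sum_i v i * laplacian A i j = lam * v j) ->
  lam * \sum_j v j = 0.
Proof.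
move=> eig; rewrite mulr_sumr; under eq_bigr do rewrite -eig.
rewrite exchange_big /= big1 // => i _.
by rewrite -mulr_sumr laplacian_row_sum mulr0.
Qed.

End Laplacian.

(** Makes the set of eigenvalues finite, which the supremum and the infimum need. By the isometry an
    eigenvector has a nonzero component along some row of [Q], and symmetry of [L] identifies the
    two eigenvalues. *)
Lemma eigenvalue_symmetric_spectral (R : realType) (n m : nat) (L : 'M[R]_n)
    (Q : 'M[R]_(m, n)) (lam : 'I_m -> R) (a : R) :
  L^T = L ->
  (forall l j, \sum_i Q l i * L i j = lam l * Q l j) ->
  (forall z : 'I_n -> R, \sum_l (\sum_i Q l i * z i) ^+ 2 = \sum_i z i ^+ 2) ->
  eigenvalue L a -> exists l, a = lam l.
Proof.
move=> symL eig iso /eigenvalueP [v vL v0].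
have vLj j : \sum_i v ord0 i * L i j = a * v ord0 j.
  by have /matrixP/(_ ord0 j) := vL; rewrite !mxE.
have [l Ql] : exists l, \sum_i Q l i * v ord0 i != 0.
  apply/existsP; apply: contraR v0; rewrite negb_exists => /forallP Q0.
  apply/eqP/rowP=> i; rewrite mxE.
  have := iso (v ord0); rewrite big1; last first.
    by move=> l _; have := Q0 l; rewrite negbK => /eqP ->; rewrite expr0n.
  move/esym/eqP; rewrite psumr_eq0; last by move=> k _; exact: sqr_ge0.
  by move=> /allP /(_ i (mem_index_enum i)) /=; rewrite sqrf_eq0 => /eqP.
exists l; apply: (mulIf Ql).
rewrite mulr_sumr (eq_bigr (fun i => \sum_j Q l i * (v ord0 j * L j i))).
  rewrite exchange_big /= mulr_sumr; apply: eq_bigr => j _.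
  rewrite mulrA -eig mulr_suml; apply: eq_bigr => i _.
  by rewrite -[in LHS]symL mxE; ring.
by move=> i _; rewrite -mulr_sumr vLj; ring.
Qed.

(* The rows of Q in the kernel of L are replaced by 0, with the dummy
   eigenvalue rho2; this turns the isometry into a projection orthogonal to
   the constants. *)
Lemma laplacian_spectral (R : realType) (n : nat) (A : 'M[R]_n)
    (rho := spectral_radius (laplacian A))
    (rho2 := smallest_pos_eigenvalue (laplacian A)) :
  (2 <= n)%N -> connected_weighted_graph A ->
  exists (m : nat) (Q : 'M[R]_(m, n)) (lam : 'I_m -> R),
    [/\ 0 < rho2, rho2 <= rho, forall l, rho2 <= lam l <= rho,
        forall l j, \sum_i Q l i * laplacian A i j = lam l * Q l j &
        forall z : 'I_n -> R, \sum_l (\sum_i Q l i * z i) ^+ 2 =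
          \sum_i (z i - n%:R^-1 * \sum_j z j) ^+ 2].
Proof.
move=> n2 graphA; set L := laplacian A in rho rho2 *.
have symL : L^T = L by exact: laplacian_sym.
have [Q [lam [eig iso]]] := symmetric_spectral symL.
have n0 : n%:R != 0 :> R by rewrite pnatr_eq0 -lt0n (leq_trans _ n2).
have i0 : 'I_n by exact: Ordinal (leq_trans (isT : (0 < 2)%N) n2).
have eigL a : eigenvalue L a -> exists l, a = lam l.
  exact: eigenvalue_symmetric_spectral symL eig iso.
have eiglam l : (exists j, Q l j != 0) -> eigenvalue L (lam l).
  move=> [j Qj]; apply/eigenvalueP; exists (row l Q).
    by apply/rowP=> k; rewrite !mxE -eig; apply: eq_bigr => i _; rewrite mxE.
  by apply: contraNneq Qj => /rowP/(_ j); rewrite !mxE => ->.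
(* A zero row is no eigenvector, so its [lam l] need not be an eigenvalue of [L]; such rows are
   discarded along with the kernel. *)
pose live l := (lam l != 0) && [exists j, Q l j != 0].
have live_gt0 l : live l -> 0 < lam l.
  move=> /andP[l0 /existsP Q0]; rewrite lt_neqAle eq_sym l0.
  exact: (laplacian_eigenvalue_ge0 graphA (eig l)).
have live_ge l : live l -> rho2 <= lam l.
  move=> ll; apply: ge_inf.
    by exists 0 => a [_ /ltW].
  split; last exact: live_gt0.
  by move: ll => /andP[_ /existsP]; exact: eiglam.
have live_le l : live l -> lam l <= rho.
  move=> ll; apply: le_trans (ler_norm _) _; apply: ub_le_sup.
    exists (\sum_l `|lam l|) => _ [a ea <-].
    have [k ->] := eigL a ea; rewrite (bigD1 k) //= lerDl.
    by apply: sumr_ge0.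
  exists (lam l) => //; move: ll => /andP[_ /existsP]; exact: eiglam.
pose Q' : 'M[R]_(n + n, n) := \matrix_(l, i) if live l then Q l i else 0.
(* A live row is orthogonal to the constants; a dead row of [Q] is zero or constant and kills every
   centered vector. Both sides thus see only the centered part of [z]. *)
have Q'E z l : \sum_i Q' l i * z i =
    \sum_i Q l i * (z i - n%:R^-1 * \sum_j z j).
  have centered : \sum_i (z i - n%:R^-1 * \sum_j z j) = 0.
    rewrite sumrB sumr_const card_ord -[X in _ - X]mulr_natl mulrA divff //.
    by rewrite mul1r subrr.
  case: (boolP (live l)) => ll.
    under eq_bigr do rewrite mxE ll.
    under [RHS]eq_bigr do rewrite mulrBr.
    rewrite sumrB -mulr_suml; have /andP[l0 _] := ll.
    have /eqP := laplacian_image_sum (eig l).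
    by rewrite mulf_eq0 (negbTE l0) /= => /eqP ->; rewrite mul0r subr0.
  rewrite big1; last by move=> i _; rewrite mxE (negbTE ll) mul0r.
  move: ll; rewrite negb_and negbK => /orP[/eqP l0|]; last first.
    rewrite negb_exists => /forallP Q0; rewrite big1 // => i _.
    by have := Q0 i; rewrite negbK => /eqP ->; rewrite mul0r.
  have cst : forall i j, Q l i = Q l j.
    apply: (laplacian_kernel_constant graphA) => j.
    by rewrite eig l0 mul0r.
  under eq_bigr do rewrite (cst _ i0).
  by rewrite -mulr_sumr centered mulr0.
have iso' z : \sum_l (\sum_i Q' l i * z i) ^+ 2 =
    \sum_i (z i - n%:R^-1 * \sum_j z j) ^+ 2.
  by under eq_bigr do rewrite Q'E; rewrite iso.
(* As [n] is at least 2, the indicator of one vertex is not constant; were all rows dead, its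
   centered part would vanish. *)
have [l0 ll0] : exists l, live l.
  apply/existsP; apply: contraT; rewrite negb_exists => /forallP dead.
  have := iso' (fun i => (i == i0)%:R).
  rewrite big1; last first.
    move=> l _; rewrite big1 ?expr0n // => i _.
    by rewrite mxE (negbTE (dead l)) mul0r.
  have -> : \sum_j (j == i0)%:R = 1 :> R.
    by rewrite (bigD1 i0) //= eqxx big1 ?addr0 // => j /negbTE ->.
  move/esym/eqP; rewrite psumr_eq0; last by move=> k _; exact: sqr_ge0.
  move=> /allP /(_ i0 (mem_index_enum i0)) /=.
  rewrite eqxx mulr1 sqrf_eq0 subr_eq0 eq_sym invr_eq1 pnatr_eq1.
  by rewrite (gtn_eqF n2).
have rho2_gt0 : 0 < rho2.
  (* An infimum of positive reals could be 0; the minimum over the finite list of positive [lam l]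
     is a positive lower bound. *)
  apply: (@lt_le_trans _ _ (\big[Num.min/1]_(l | 0 < lam l) lam l)).
    by apply: (big_ind (fun x => 0 < x)) => // x y x0 y0; rewrite lt_min x0.
  apply: lb_le_inf.
    exists (lam l0); split; last exact: live_gt0.
    by move: ll0 => /andP[_ /existsP]; exact: eiglam.
  move=> a [/eigL[l ->] l_gt0].
  by rewrite (bigD1 l) //= ge_min lexx.
have rho2_le : rho2 <= rho by apply: le_trans (live_ge _ ll0) (live_le _ ll0).
exists (n + n)%N, Q', (fun l => if live l then lam l else rho2); split => //.
  by move=> l; case: ifP => ll; rewrite ?lexx ?rho2_le // live_ge // live_le.
move=> l j; case: (boolP (live l)) => ll.
  by rewrite mxE ll -eig; apply: eq_bigr => i _; rewrite mxE ll.
rewrite mxE (negbTE ll) mulr0 big1 // => i _.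
by rewrite mxE (negbTE ll) mul0r.
Qed.

(** * Consequences of the parameter bounds *)

Lemma lt_divl_mul (R : realFieldType) (x y c : R) :
  0 < y -> x < c / y -> x * y <= c.
Proof. by move=> y0; rewrite ltr_pdivlMr // => /ltW. Qed.

Section StepSize.
Context (R : realType).
Variables (rho rho2 Lf phi r alpha beta eta psi kappa1 kappa4 : R).
Let s := phi * psi * r.
Hypotheses (rho2_gt0 : 0 < rho2) (rho2_le : rho2 <= rho) (Lf_gt0 : 0 < Lf)
  (s_gt0 : 0 < s) (s_le1 : s <= 1) (kappa4_gt0 : 0 < kappa4)
  (kappa1_ge : Num.max ((9 + kappa4) / (2 * rho2)) 1 <= kappa1)
  (alpha_def : alpha = kappa1 * beta)
  (beta_gt : kappa2 rho2 Lf kappa1 kappa4 < beta)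
  (eta_gt0 : 0 < eta)
  (eta_lt1 : eta < eps1 rho2 Lf alpha beta / eps2 rho Lf phi r alpha beta psi)
  (eta_lt3 : eta < eps3 rho2 beta / eps4 rho rho2 phi r beta psi).

Lemma kappa1_ge1 : 1 <= kappa1.
Proof. by move: kappa1_ge; rewrite ge_max => /andP[]. Qed.

Lemma kappa5_lt_beta : kappa5 rho2 Lf kappa4 < beta.
Proof. by move: beta_gt; rewrite gt_max => /andP[]. Qed.

Lemma kappa5_gt0 : 0 < kappa5 rho2 Lf kappa4.
Proof. by rewrite lt_max [X in _ || X]divr_gt0 ?orbT. Qed.

Lemma beta_gt0 : 0 < beta.
Proof. exact: lt_trans kappa5_gt0 kappa5_lt_beta. Qed.

Lemma alpha_ge_beta : beta <= alpha.
Proof. by rewrite alpha_def ler_peMl ?kappa1_ge1 // ltW // beta_gt0. Qed.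

Lemma beta_rho2_gt6 : 6 < beta * rho2.
Proof.
by have := kappa5_lt_beta; rewrite gt_max => /andP[_]; rewrite ltr_pdivrMr.
Qed.

(** This is [0 <= eps1] cleared of denominators: [kappa1] provides [9 + kappa4], and [kappa5 < beta]
    turns [kappa4 * beta] into [4 + 5 * Lf ^+ 2]. *)
Lemma alpha_rho2_ge : 9 * beta + 4 + 5 * Lf ^+ 2 <= 2 * (alpha * rho2).
Proof.
have := kappa5_lt_beta; rewrite gt_max => /andP[]; rewrite ltr_pdivrMr // => k4 _.
have : 9 + kappa4 <= kappa1 * (2 * rho2).
  by move: kappa1_ge; rewrite ge_max ler_pdivrMr ?mulr_gt0 // => /andP[].
by move=> /(ler_wpM2l (ltW beta_gt0)); rewrite alpha_def; lra.
Qed.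

Lemma alpha_rho2_ge_beta : 9 / 2 * beta <= alpha * rho2.
Proof. by have := alpha_rho2_ge; have := sqr_ge0 Lf; lra. Qed.

Lemma alpha_rho2_ge6 : 6 <= alpha * rho2.
Proof.
apply: le_trans (ltW beta_rho2_gt6) _.
by rewrite ler_wpM2r ?alpha_ge_beta // ltW.
Qed.

Lemma alpha_rho_ge : alpha * rho2 <= alpha * rho.
Proof. by rewrite ler_wpM2l // (le_trans (ltW beta_gt0)) ?alpha_ge_beta. Qed.

Let z := s^-1.

Lemma invs_ge1 : 1 <= z.
Proof. by rewrite invf_ge1. Qed.

Lemma eps2E : eps2 rho Lf phi r alpha beta psi =
  (8 * z + 7) * ((alpha * rho) ^+ 2 + Lf ^+ 2) + 2 * beta ^+ 2 + 1.
Proof.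
rewrite /eps2 -/s.
have -> : 4 * (2 + s) / s = 8 * z + 4.
  by rewrite /z; field; exact: lt0r_neq0.
by rewrite exprMn; ring.
Qed.

(** The first bound on [eta], with [2 * beta ^+ 2 + 1] dropped from [eps2]; the smallness conditions
    down to [eta_beta] all derive from it. *)
Lemma eta_eps1 : eta * (8 * z + 7) * ((alpha * rho) ^+ 2 + Lf ^+ 2) <=
  eps1 rho2 Lf alpha beta.
Proof.
have z1 := invs_ge1.
have e2 : 0 < eps2 rho Lf phi r alpha beta psi.
  rewrite eps2E ltr_wpDl // addr_ge0 //; last by rewrite mulr_ge0 ?sqr_ge0.
  by apply: mulr_ge0; [lra|rewrite addr_ge0 ?sqr_ge0].
apply: le_trans (lt_divl_mul e2 eta_lt1); rewrite eps2E -mulrA ler_pM2l //.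
by have := sqr_ge0 beta; lra.
Qed.

Lemma eta_alpha_rho : eta * (alpha * rho) * (8 * z + 7) <= 1 / 2.
Proof.
have B6 := le_trans alpha_rho2_ge6 alpha_rho_ge.
have B0 : 0 < alpha * rho by lra.
have z1 := invs_ge1.
have E : eta * (8 * z + 7) * (alpha * rho) ^+ 2 <= alpha * rho / 2.
  apply: le_trans (_ : eps1 rho2 Lf alpha beta <= _).
    apply: le_trans eta_eps1; rewrite ler_wpM2l ?lerDl ?sqr_ge0 //.
    by rewrite mulr_ge0 ?(ltW eta_gt0) //; lra.
  by rewrite /eps1; have := alpha_rho_ge; have := beta_gt0;
    have := sqr_ge0 Lf; lra.
by rewrite -(ler_pM2r B0); lra.
Qed.

Lemma eta_Lf : eta * Lf <= 1 / 60.
Proof.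
have B6 := le_trans alpha_rho2_ge6 alpha_rho_ge.
have B0 : 0 < alpha * rho by lra.
have z1 := invs_ge1.
have e1 : eps1 rho2 Lf alpha beta <= alpha * rho / 2.
  by rewrite /eps1; have := alpha_rho_ge; have := beta_gt0;
    have := sqr_ge0 Lf; lra.
(* Here [15 <= 8 * z + 7], and the double product is at most the sum of the squares. *)
have E : eta * 15 * (2 * (alpha * rho) * Lf) <= alpha * rho / 2.
  apply: le_trans e1; apply: le_trans eta_eps1; apply: ler_pM.
  - by rewrite mulr_ge0 // ltW.
  - by apply: mulr_ge0; [lra|exact: ltW].
  - by rewrite ler_pM2l //; lra.
  - by have := sqr_ge0 (alpha * rho - Lf); lra.
by rewrite -(ler_pM2r B0); lra.
Qed.

Lemma eta_invs : eta * (8 * z + 7) <= 1 / 12.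
Proof.
have B6 := le_trans alpha_rho2_ge6 alpha_rho_ge.
have z1 := invs_ge1.
have T0 : 0 <= eta * (8 * z + 7) by rewrite mulr_ge0 ?(ltW eta_gt0) //; lra.
by have := ler_wpM2l T0 B6; have := eta_alpha_rho; lra.
Qed.

Lemma eta_le : eta <= 1 / 100.
Proof.
have z1 := invs_ge1; have := ler_wpM2l (ltW eta_gt0) z1; have := eta_invs; lra.
Qed.

Lemma eta_beta_invs : eta * beta * (8 * z + 7) <= 1 / 9.
Proof.
have z1 := invs_ge1.
have T0 : 0 <= eta * (8 * z + 7) by rewrite mulr_ge0 ?(ltW eta_gt0) //; lra.
have : 9 / 2 * beta <= alpha * rho.
  by have := alpha_rho2_ge; have := alpha_rho_ge; have := sqr_ge0 Lf; lra.
by move=> /(ler_wpM2l T0); have := eta_alpha_rho; lra.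
Qed.

Lemma eta_beta : eta * beta <= 1 / 100.
Proof.
have z1 := invs_ge1.
have T0 : 0 <= eta * beta by rewrite mulr_ge0 // ltW // beta_gt0.
by have := ler_wpM2l T0 z1; have := eta_beta_invs; lra.
Qed.

(** The second bound on [eta] is stated with [rho ^+ 2]; multiplied by [lam] it controls [lam ^+ 2]
    provided [lam <= rho ^+ 2], which holds for [1 <= rho]. For [rho < 1] one has [lam <= 1], and
    [eta_beta_invs] with [6 < beta * lam] suffices. *)
Lemma eta_beta_lam lam : rho2 <= lam <= rho ->
  eta * (6 + 6 * z) * (beta * lam) ^+ 2 <= beta * lam / 2 - 1.
Proof.
move=> /andP[l2 lr]; have z1 := invs_ge1; have b0 := beta_gt0.
have l0 : 0 < lam by apply: lt_le_trans l2.
have bl : 6 < beta * lam.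
  by apply: lt_le_trans beta_rho2_gt6 _; rewrite ler_pM2l.
have T0 : 0 <= eta * (8 * z + 7) by rewrite mulr_ge0 ?(ltW eta_gt0) //; lra.
have [rho1|rho1] := leP 1 rho.
  have e40 : 0 < eps4 rho rho2 phi r beta psi.
    rewrite /eps4 -/s ltr_wpDl ?invr_gt0 // addr_ge0 //.
      by rewrite !mulr_ge0 ?sqr_ge0 //; lra.
    rewrite divr_ge0 ?(ltW s_gt0) // mulr_ge0 ?sqr_ge0 //.
    by rewrite mulr_ge0 ?sqr_ge0 //; have := s_gt0; lra.
  have := lt_divl_mul e40 eta_lt3; rewrite /eps4 -/s.
  have -> : 4 * (2 + s) * beta ^+ 2 * rho ^+ 2 / s =
      (8 * z + 4) * (beta * rho) ^+ 2.
    by rewrite /z; field; exact: lt0r_neq0.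
  have U1 : 0 <= eta * (2 * beta ^+ 2 * rho).
    by rewrite !mulr_ge0 ?sqr_ge0 ?(ltW eta_gt0) //; lra.
  have U2 : 0 <= eta * rho2^-1 by rewrite mulr_ge0 ?invr_ge0 // ltW.
  have U3 : 0 <= eta * (2 * z - 2) * (beta * rho) ^+ 2.
    by rewrite mulr_ge0 ?sqr_ge0 // mulr_ge0 ?(ltW eta_gt0) //; lra.
  move=> V; have {V U1 U2 U3} V : eta * (6 + 6 * z) * (beta * rho) ^+ 2 <=
      beta / 2 - 3 * rho2^-1 by rewrite /eps3 in V; lra.
  have l_rho : lam <= rho ^+ 2.
    by rewrite expr2 (le_trans lr) // ler_peMl //; lra.
  apply: (@le_trans _ _ (lam * (eta * (6 + 6 * z) * (beta * rho) ^+ 2))).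
    rewrite !exprMn [leRHS]mulrCA ler_wpM2l //.
      by rewrite mulr_ge0 ?(ltW eta_gt0) //; lra.
    by rewrite [leRHS]mulrCA ler_wpM2l ?sqr_ge0 // expr2 ler_pM2l.
  apply: (le_trans (ler_wpM2l (ltW l0) V)).
  have : 1 <= lam * rho2^-1 by rewrite ler_pdivlMr ?mul1r.
  by lra.
have W1 : 0 <= (1 / 9 - eta * beta * (8 * z + 7)) * (beta * lam ^+ 2).
  rewrite mulr_ge0 ?subr_ge0 ?eta_beta_invs //.
  by rewrite mulr_ge0 ?sqr_ge0 // ltW.
have W2 : 0 <= eta * (2 * z + 1) * (beta * lam) ^+ 2.
  by rewrite mulr_ge0 ?sqr_ge0 // mulr_ge0 ?(ltW eta_gt0) //; lra.
have W3 : 0 <= beta * lam * (1 - lam).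
  by rewrite !mulr_ge0 ?(ltW b0) ?(ltW l0) // subr_ge0; lra.
by lra.
Qed.

(** Multiplied by [4 * beta ^+ 2], the left side is [kappa6] with [kappa5] replaced by the larger
    [beta], and [kappa6 <= beta ^+ 2]. *)
Lemma dual_drift_coef : Lf ^+ 2 * ((beta * rho2)^-2
  + 2 * ((alpha + beta) / beta ^+ 2) ^+ 2 / (beta * rho2)) <= 1 / 4.
Proof.
have b0 := beta_gt0; have k5 := kappa5_gt0.
have /ltW k6 : Num.sqrt (kappa6 rho2 Lf kappa1 kappa4) < beta.
  by move: beta_gt; rewrite gt_max => /andP[].
have k60 : 0 <= kappa6 rho2 Lf kappa1 kappa4.
  by apply: addr_ge0; apply: divr_ge0;
    do ?[exact: sqr_ge0 | exact: ltW | apply: mulr_ge0].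
have {}k6 : kappa6 rho2 Lf kappa1 kappa4 <= beta ^+ 2.
  by rewrite -(sqr_sqrtr k60) lerXn2r // nnegrE ?sqrtr_ge0 // ltW.
have bb : 0 < beta ^+ 2 by rewrite exprn_gt0.
have -> : Lf ^+ 2 * ((beta * rho2)^-2
    + 2 * ((alpha + beta) / beta ^+ 2) ^+ 2 / (beta * rho2)) =
    (4 * Lf ^+ 2 / rho2 ^+ 2
     + 8 * (kappa1 + 1) ^+ 2 * Lf ^+ 2 / (beta * rho2)) / (4 * beta ^+ 2).
  by rewrite alpha_def; field; rewrite !lt0r_neq0.
rewrite ler_pdivrMr ?mulr_gt0 // (_ : 1 / 4 * _ = beta ^+ 2); last by field.
apply: le_trans k6; rewrite /kappa6 addrC lerD2r ler_wpM2l //.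
  by do ?[exact: sqr_ge0 | apply: mulr_ge0].
by rewrite lef_pV2 ?posrE ?mulr_gt0 // ler_pM2r // ltW // kappa5_lt_beta.
Qed.

End StepSize.

(** The threshold is the larger root of [A * t ^+ 2 + 2 * B * t = Q]; below it the quadratic is at
    most [Q], and the square is then dropped. *)
Lemma quadratic_below_root (R : rcfType) (A B Q t : R) :
  0 < A -> 0 <= B -> 0 <= t -> t < (Num.sqrt (B ^+ 2 + A * Q) - B) / A ->
  2 * B * t <= Q.
Proof.
move=> A0 B0 t0; rewrite ltr_pdivlMr // ltrBrDr => h.
have tAB : 0 <= t * A + B by rewrite addr_ge0 // mulr_ge0 // ltW.
(* For a negative discriminant [Num.sqrt] returns 0, against [0 <= t * A + B]. *)
have disc0 : 0 <= B ^+ 2 + A * Q.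
  by rewrite leNgt; apply/negP => /ltW /ler0_sqrtr E; rewrite E ltNge tAB in h.
have : (t * A + B) ^+ 2 <= B ^+ 2 + A * Q.
  by rewrite -(sqr_sqrtr disc0) lerXn2r ?nnegrE ?sqrtr_ge0 // ltW.
have -> : (t * A + B) ^+ 2 = B ^+ 2 + A * (A * t ^+ 2 + 2 * B * t) by ring.
rewrite lerD2l ler_pM2l //; apply: le_trans.
by rewrite lerDr mulr_ge0 ?sqr_ge0 // ltW.
Qed.

Lemma eps8E (R : realType) (rho phi r alpha beta : R) :
  eps8 rho phi r alpha beta =
  cr0 phi r * (alpha * rho / 2 + beta * rho + 2 * beta).
Proof. by rewrite /eps8; field. Qed.

Lemma cr0_ge0 (R : realType) (phi r : R) : phi <= 1 -> 0 <= cr0 phi r.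
Proof.
move=> phi1; apply: addr_ge0; first apply: mulr_ge0; rewrite ?subr_ge0 //;
  by rewrite mulr_ge0 ?sqr_ge0.
Qed.

Lemma cr2_gt0 (R : realType) (r1 : R) : 1 < r1 -> 0 < cr2 r1.
Proof. by move=> r11; rewrite divr_gt0 ?subr_gt0 // (lt_trans ltr01). Qed.

(** Keeps the coefficient of the gap below 1: one step multiplies the gap by at most [1 - eps7] plus
    this left side. The root [tau1] has [A = 2 * r2 * e9] and [B = r2 * e8], where [e8] is [cr0]
    times the long parenthesis. *)
Lemma tau1_condition (R : realType)
    (rho phi r r1 tau0 alpha beta psi eta : R) :
  0 <= rho -> 0 < phi * psi * r -> phi <= 1 -> 1 < r1 -> 0 <= alpha ->
  0 <= beta -> 0 <= eta ->
  (eta%:E < tau1 rho phi r r1 tau0 alpha beta psi)%E ->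
  (tau0 + 2 * eta * (alpha * rho / 2 + beta * rho + 2 * beta))
    * (cr0 phi r * cr2 r1) <= eps7 phi r psi.
Proof.
move=> rho0 s0 phi1 r11 al0 be0 eta0; rewrite /tau1.
have r20 := cr2_gt0 r11; set r2 := cr2 r1 in r20 *.
case: eqP => [-> _|/eqP r0n].
  by rewrite mul0r mulr0 /eps7 mulr_ge0 ?divr_ge0 ?addr_ge0 // ltW.
have r00 : 0 < cr0 phi r by rewrite lt_neqAle eq_sym r0n cr0_ge0.
have e80 : 0 <= eps8 rho phi r alpha beta.
  rewrite eps8E.
  by do ?[exact: ltW | apply: mulr_ge0 | apply: addr_ge0].
have e90 : 0 < eps9 rho phi r alpha beta psi.
  rewrite /eps9 ltr_wpDl //.
    apply: divr_ge0; last exact: ltW.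
    have -> : 8 + 7 * phi * psi * r = 8 + 7 * (phi * psi * r) by ring.
    by do ?[exact: sqr_ge0 | exact: ltW | apply: mulr_ge0 | apply: addr_ge0].
  by rewrite mulr_gt0 // ltr_wpDl // mulr_ge0 ?sqr_ge0.
set e8 := eps8 _ _ _ _ _ in e80 *; set e9 := eps9 _ _ _ _ _ _ in e90 *.
set N := eps7 _ _ _ - _; rewrite lte_fin -exprMn.
move=> /(quadratic_below_root _ _ eta0) h.
have {}h : 2 * (r2 * e8) * eta <= N.
  by apply: h; [apply: mulr_gt0 e90; exact: mulr_gt0|exact: mulr_ge0 (ltW r20) e80].
by move: h; rewrite /e8 eps8E /N; lra.
Qed.

(** Keeps the coefficient of the memory below its weight [tau0]; [check_eps8] is twice the long
    parenthesis times [(cr0 * r1 + 1) * sigma ^+ 2]. *)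
Lemma tau2_condition (R : realType)
    (rho phi r r1 tau0 alpha beta sigma eta : R) :
  0 <= rho -> phi <= 1 -> 1 < r1 -> 0 <= alpha ->
  0 <= beta -> 0 <= eta -> 0 < sigma ->
  eta < tau2 rho phi r r1 tau0 alpha beta sigma ->
  tau0 * (cr0 phi r * r1 * sigma ^+ 2) +
  2 * eta * (alpha * rho / 2 + beta * rho + 2 * beta)
    * ((cr0 phi r * r1 + 1) * sigma ^+ 2) <= tau0.
Proof.
move=> rho0 phi1 r11 al0 be0 eta0 sg0; rewrite /tau2.
have r00 := cr0_ge0 r phi1.
have r10 : 0 < r1 by apply: lt_trans r11.
have K0 : 0 < cr0 phi r * r1 + 1 by rewrite ltr_wpDl // mulr_ge0 // ltW.
have e80 : 0 <= check_eps8 rho phi r r1 alpha beta sigma.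
  rewrite /check_eps8 mulr_ge0 ?sqr_ge0 // mulr_ge0 ?(ltW K0) //.
  by do ?[apply: mulr_ge0 | apply: addr_ge0].
have e90 : 0 < check_eps9 rho phi r r1 alpha beta sigma.
  rewrite /check_eps9 !mulr_gt0 ?exprn_gt0 // ltr_wpDl //.
  by do ?[exact: sqr_ge0 | apply: mulr_ge0 | apply: addr_ge0].
set e8 := check_eps8 _ _ _ _ _ _ _ in e80 *.
set e9 := check_eps9 _ _ _ _ _ _ _ in e90 *.
set N := 1 - _.
have -> : 4 * N * tau0 * e9 = (2 * e9) * (2 * (N * tau0)) by ring.
move=> /(quadratic_below_root (mulr_gt0 (ltr0Sn _ 1) e90) e80 eta0).
have -> : 2 * e8 * eta = 2 * (e8 * eta) by ring.
rewrite ler_pM2l // /e8 /check_eps8 /N; lra.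
Qed.

(** * One step of the algorithm *)

Lemma enormZ_sq (R : realType) (d : nat) (c : R) (x : 'rV[R]_d) :
  enorm (c *: x) ^+ 2 = c ^+ 2 * enorm x ^+ 2.
Proof.
rewrite !enorm_sqE mulr_sumr; apply: eq_bigr => j _.
by rewrite mxE exprMn.
Qed.

Section Descent.
Context (R : realType) (d : nat).
Implicit Types (f : 'rV[R]_d -> R) (x y v : 'rV[R]_d).

Definition dot (x y : 'rV[R]_d) : R := \sum_j x ord0 j * y ord0 j.

Lemma derive_grad f x v : differentiable f x -> 'D_v f x = dot (grad f x) v.
Proof.
move=> df; rewrite deriveE // {1}(row_sum_delta v) linear_sum /=.
apply: eq_bigr => j _; rewrite linearZ /= mulrC mxE deriveE //.
Qed.

Lemma is_derive_line f x v t : differentiable f (x + t *: v) ->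
  is_derive t 1 (fun t => f (x + t *: v)) (dot (grad f (x + t *: v)) v).
Proof.
move=> df; have dv : derivable f (x + t *: v) v by exact: diff_derivable.
have E : (fun h : R => h^-1 *: (((fun t => f (x + t *: v)) \o shift t) (h *: 1)
                             - f (x + t *: v))) =
  (fun h : R => h^-1 *: ((f \o shift (x + t *: v)) (h *: v) - f (x + t *: v))).
  apply/funext => h /=; congr (_ *: (f _ - _)).
  by rewrite [h *: 1]mulr1 scalerDl addrCA addrC addrAC.
apply: DeriveDef; first by rewrite /derivable E.
by rewrite /derive E -derive_grad.
Qed.

(** The mean value theorem for [phi], whose derivative is nonpositive on the open interval by the
    Lipschitz bound, replaces the usual integral along the segment. *)
Lemma descent_lemma f (M : R) x y : 0 < M -> (forall x, differentiable f x) ->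
  (forall x y, enorm (grad f x - grad f y) <= M * enorm (x - y)) ->
  f y <= f x + dot (grad f x) (y - x) + M / 2 * enorm (y - x) ^+ 2.
Proof.
move=> M0 df lip; set v := y - x.
pose A := dot (grad f x) v; pose B := M / 2 * enorm v ^+ 2.
pose g (t : R) := f (x + t *: v).
pose phi : R -> R := g - (A \*: (id : R -> R)) - (B \*: ((id : R -> R) ^+ 2)).
have phiE (t : R) : phi t = f (x + t *: v) - A * t - B * t ^+ 2 by [].
have dphi (t : R) : is_derive t (1 : R) phi
    (dot (grad f (x + t *: v)) v - A - 2 * B * t).
  have dg : is_derive t (1 : R) g (dot (grad f (x + t *: v)) v).
    exact: is_derive_line.
  apply: is_derive_eq; rewrite /GRing.scale /=; ring.
have [c c01 E] : exists2 c, c \in `]0, 1[%R &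
    phi 1 - phi 0 = (dot (grad f (x + c *: v)) v - A - 2 * B * c) * (1 - 0).
  apply: MVT => //; apply: derivable_within_continuous => t _.
  exact: ex_derive.
have c0 : 0 < c by move: c01; rewrite in_itv /= => /andP[].
have E1 : phi 1 = f y - A - B.
  by rewrite phiE scale1r subrKC; ring.
have E0 : phi 0 = f x.
  by rewrite phiE scale0r addr0; ring.
have cs : dot (grad f (x + c *: v)) v - A <= 2 * B * c.
  rewrite /A /dot -sumrB.
  set a := grad f (x + c *: v) - grad f x.
  have na : enorm a ^+ 2 <= (M * c) ^+ 2 * enorm v ^+ 2.
    have : enorm a ^+ 2 <= (M * enorm (c *: v)) ^+ 2.
      rewrite lerXn2r ?nnegrE ?mulr_ge0 ?sqrtr_ge0 ?(ltW M0) //.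
      by have := lip (x + c *: v) x; rewrite [x + _ - _]addrAC subrr add0r.
    by rewrite [in X in _ -> X]exprMn exprMn enormZ_sq mulrA.
  have K0 : 0 < M * c by rewrite mulr_gt0.
  (* Young's inequality with weight [M * c] stands in for Cauchy-Schwarz; either half is at most
     [M * c / 2 * enorm v ^+ 2]. *)
  apply: (@le_trans _ _ (enorm a ^+ 2 / (2 * (M * c)) + M * c / 2 * enorm v ^+ 2)).
    rewrite !enorm_sqE mulr_suml mulr_sumr -big_split /=; apply: ler_sum => j _.
    rewrite -mulrBl; set aj := a ord0 j; set vj := v ord0 j.
    have -> : (grad f (x + c *: v)) ord0 j - (grad f x) ord0 j = aj.
      by rewrite /aj !mxE.
    rewrite -subr_ge0.
    have -> : aj ^+ 2 / (2 * (M * c)) + M * c / 2 * vj ^+ 2 - aj * vj =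
        (aj - M * c * vj) ^+ 2 / (2 * (M * c)).
      by field; rewrite !lt0r_neq0.
    by rewrite divr_ge0 ?sqr_ge0 // mulr_ge0 // ltW.
  have : enorm a ^+ 2 / (2 * (M * c)) <= M * c / 2 * enorm v ^+ 2.
    rewrite ler_pdivrMr ?mulr_gt0 //; apply: le_trans na _.
    by rewrite le_eqVlt; apply/orP; left; apply/eqP; field.
  rewrite /B; lra.
move: E; rewrite E1 E0 subr0 mulr1 => E.
by rewrite -/A -/B; lra.
Qed.

Lemma grad_avg (n : nat) (f : 'I_n -> 'rV[R]_d -> R) x :
  (forall i x, differentiable (f i) x) ->
  grad (avg f) x = mean (fun i => grad (f i) x).
Proof.
move=> df; apply/rowP=> j; rewrite !mxE summxE.
have -> : avg f = n%:R^-1 \*: (\sum_i f i).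
  by apply/funext => z; rewrite /avg /= fct_sumE.
have dv i : derivable (f i) x (delta_mx ord0 j) by exact: diff_derivable.
rewrite deriveZ ?derive_sum //; last exact: derivable_sum.
by congr (_ *: _); apply: eq_bigr => i _; rewrite mxE.
Qed.

End Descent.

(** * Families of vectors, their means and their modes *)

Section Families.
Context (R : realType) (n d : nat).
Implicit Types x y : 'I_n -> 'rV[R]_d.

Definition nsq x : R := \sum_i enorm (x i) ^+ 2.

Definition centered x : 'I_n -> 'rV[R]_d := fun i => x i - mean x.

Lemma nsq_ge0 x : 0 <= nsq x.
Proof. by apply: sumr_ge0 => i _; exact: sqr_ge0. Qed.

Lemma mean_coord x j : (mean x) ord0 j = n%:R^-1 * \sum_i x i ord0 j.
Proof. by rewrite mxE summxE. Qed.

Lemma centered_coord x i j :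
  centered x i ord0 j = x i ord0 j - n%:R^-1 * \sum_k x k ord0 j.
Proof. by rewrite mxE [X in _ + X]mxE mean_coord. Qed.

(** Pythagoras: constant families are orthogonal to centered ones. *)
Lemma nsq_centered x : (0 < n)%N ->
  nsq x = nsq (centered x) + n%:R * enorm (mean x) ^+ 2.
Proof.
move=> n0; have nn0 : n%:R != 0 :> R by rewrite pnatr_eq0 -lt0n.
rewrite /nsq; under eq_bigr do rewrite enorm_sqE.
under [in RHS]eq_bigr do rewrite enorm_sqE.
rewrite enorm_sqE mulr_sumr exchange_big [in RHS]exchange_big -big_split /=.
apply: eq_bigr => j _; rewrite mean_coord; set s := \sum_i x i ord0 j.
under [in RHS]eq_bigr do rewrite centered_coord -/s sqrrB.
rewrite big_split /= sumrB sumr_const card_ord.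
have -> : \sum_i x i ord0 j * (n%:R^-1 * s) *+ 2 = n%:R^-1 * s ^+ 2 *+ 2.
  by rewrite sumrMnl -mulr_suml -/s; congr (_ *+ 2); ring.
by rewrite -[X in _ + X + _]mulr_natl; field.
Qed.

Lemma nsq_centered_le x : (0 < n)%N -> nsq (centered x) <= nsq x.
Proof. by move=> n0; rewrite (nsq_centered x) // lerDl mulr_ge0 ?sqr_ge0. Qed.

Lemma enorm_mean_le x : (0 < n)%N -> n%:R * enorm (mean x) ^+ 2 <= nsq x.
Proof. by move=> n0; rewrite (nsq_centered x) // lerDr nsq_ge0. Qed.

End Families.

Section Modes.
Context (R : realType) (n d m : nat) (Q : 'M[R]_(m, n)).
Implicit Types x y : 'I_n -> 'rV[R]_d.

(** The Laplacian mixes agents but not coordinates, so each pair of a row [l] and a coordinate [j]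
    gives an independent scalar system. *)
Definition mode x l j : R := \sum_i Q l i * x i ord0 j.

Lemma modeD x y l j : mode (fun i => x i + y i) l j = mode x l j + mode y l j.
Proof. by rewrite -big_split; apply: eq_bigr => i _; rewrite mxE mulrDr. Qed.

Lemma modeN x l j : mode (fun i => - x i) l j = - mode x l j.
Proof. by rewrite -sumrN; apply: eq_bigr => i _; rewrite mxE mulrN. Qed.

Lemma modeZ (a : R) x l j : mode (fun i => a *: x i) l j = a * mode x l j.
Proof. by rewrite mulr_sumr; apply: eq_bigr => i _; rewrite mxE mulrCA. Qed.

Lemma mode_eigen (L : 'M[R]_n) (lam : 'I_m -> R) x l j :
  (forall l j, \sum_i Q l i * L i j = lam l * Q l j) ->
  mode (fun i => \sum_k L i k *: x k) l j = lam l * mode x l j.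
Proof.
move=> eig; rewrite /mode.
under eq_bigr do rewrite summxE mulr_sumr; rewrite exchange_big mulr_sumr /=.
apply: eq_bigr => k _; rewrite mulrA -eig mulr_suml.
by apply: eq_bigr => i _; rewrite mxE mulrA.
Qed.

Lemma mode_parseval x :
  (forall z : 'I_n -> R, \sum_l (\sum_i Q l i * z i) ^+ 2 =
     \sum_i (z i - n%:R^-1 * \sum_j z j) ^+ 2) ->
  \sum_l \sum_j mode x l j ^+ 2 = nsq (centered x).
Proof.
move=> iso; rewrite exchange_big /nsq /=; under [RHS]eq_bigr do rewrite enorm_sqE.
rewrite [RHS]exchange_big; apply: eq_bigr => j _.
rewrite (iso (fun i => x i ord0 j)); apply: eq_bigr => i _.
by rewrite centered_coord.
Qed.

End Modes.

Section ModesStep.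
Context (R : realType) (n d m : nat) (L : 'M[R]_n) (Q : 'M[R]_(m, n))
  (lam : 'I_m -> R).
Variables (rho rho2 eta z al be : R).
Let k := (al + be) / be ^+ 2.
Hypotheses (rho2_gt0 : 0 < rho2) (lamP : forall l, rho2 <= lam l <= rho)
  (eig : forall l j, \sum_i Q l i * L i j = lam l * Q l j)
  (iso : forall z : 'I_n -> R, \sum_l (\sum_i Q l i * z i) ^+ 2 =
     \sum_i (z i - n%:R^-1 * \sum_j z j) ^+ 2)
  (eta_gt0 : 0 < eta) (z_ge1 : 1 <= z) (be_gt0 : 0 < be) (be_le : be <= al)
  (al_ge : 9 / 2 * be <= al * rho2)
  (eta_be : eta * be <= 1 / 100) (eta_le : eta <= 1 / 100)
  (eta_al : eta * (al * rho) * (8 * z + 7) <= 1 / 2)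
  (eta_be_lam : forall l, eta * (6 + 6 * z) * (be * lam l) ^+ 2 <=
     be * lam l / 2 - 1).

(** Dividing by [lam l] inverts the Laplacian on the complement of the constants; the weight
    [k * (be * lam l)] is the one that cancels the products [x y] in that mode. *)
Definition modes_energy (x w : 'I_n -> 'rV[R]_d) : R :=
  \sum_l \sum_j mode_energy (k * (be * lam l)) (mode Q x l j)
    (mode Q w l j / lam l).

Lemma lam_gt0 l : 0 < lam l.
Proof. by have /andP[+ _] := lamP l; exact: lt_le_trans. Qed.

Lemma modes_energy_ge0 x w : 0 <= modes_energy x w.
Proof.
apply: sumr_ge0 => l _; apply: sumr_ge0 => j _; apply: mode_energy_ge0.
have l0 := lam_gt0 l; have al0 : 0 < al := lt_le_trans be_gt0 be_le.
have -> : k * (be * lam l) = (al * lam l + be * lam l) / be.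
  by rewrite /k; field; exact: lt0r_neq0.
have /andP[l2 _] := lamP l.
rewrite ler_pdivlMr // mul1r.
have : 0 < be * lam l by rewrite mulr_gt0.
by have := ler_wpM2l (ltW al0) l2; have := be_gt0; have := al_ge; lra.
Qed.

Lemma modes_step (x xh v G g g' Lxh h : 'I_n -> 'rV[R]_d) :
  (Lxh = fun i => \sum_j L i j *: xh j) ->
  (h = fun i => al *: Lxh i + be *: v i + G i) ->
  modes_energy (fun i => x i - eta *: h i)
    (fun i => v i + (eta * be) *: Lxh i + be^-1 *: g' i)
  + (1 + 2 * z) * eta ^+ 2 * nsq (centered h)
  <= modes_energy x (fun i => v i + be^-1 *: g i)
   + eta * (- (al * rho2 / 2 - 9 / 8 * be - 1) * nsq (centered x)
     + (al * rho / 2 + be * rho + 2 * be) * nsq (centered (fun i => x i - xh i))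
     + (3 / 4 + eta * (6 + 6 * z)) * nsq (centered (fun i => G i - g i)))
   + ((be * rho2)^-2 + 2 * k ^+ 2 / (be * rho2)) / eta
     * nsq (centered (fun i => g' i - g i)).
Proof.
move=> -> ->.
rewrite -!(mode_parseval _ iso) /modes_energy.
have al0 : 0 < al := lt_le_trans be_gt0 be_le.
rewrite !mulr_sumr -!big_split /= !mulr_sumr -!big_split /=.
apply: ler_sum => l _.
rewrite !mulr_sumr -!big_split /= !mulr_sumr -!big_split /=.
apply: ler_sum => j _.
have l0 := lam_gt0 l; have /andP[l2 lr] := lamP l.
have b0 : 0 < be * lam l by rewrite mulr_gt0.
rewrite !(modeD, modeN, modeZ, mode_eigen _ _ _ eig).
rewrite -/(mode Q x l j) -/(mode Q xh l j).
set X := mode Q x l j; set XH := mode Q xh l j; set V := mode Q v l j.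
set GG := mode Q G l j; set g0 := mode Q g l j; set g1 := mode Q g' l j.
(* The dual equilibrium moves by [eta * g] in [mode_descent], hence the division of [g1 - g0] by
   [eta] besides [be * lam l]. *)
have md := @mode_descent R eta z (al * lam l) (be * lam l) be k X (X - XH)
  ((V + be^-1 * g0) / lam l) (GG - g0) ((g1 - g0) / (be * lam l * eta))
  eta_gt0 b0 be_gt0 z_ge1.
have {}md := md ltac:(by rewrite /k; field; exact: lt0r_neq0).
have {}md := md ltac:(by rewrite ler_pM2r).
have {}md := md ltac:(by apply: le_trans al_ge _; rewrite ler_pM2l).
have E1 : eta * (al * lam l) * (8 * z + 7) <= 1 / 2.
  apply: le_trans eta_al; rewrite ler_wpM2r ?ler_pM2l //.
  by have := z_ge1; lra.
have {}md := md eta_be eta_le E1 (eta_be_lam l).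
have {}md := md _ ltac:(reflexivity).
set h0 := (al * lam l * _ + _ + _) in md.
have h0E : h0 = al * (lam l * XH) + be * V + GG.
  by rewrite /h0; field; rewrite !lt0r_neq0.
rewrite h0E in md.
have yE : (V + be^-1 * g0) / lam l +
    eta * (be * (X - (X - XH)) + (g1 - g0) / (be * lam l * eta)) =
    (V + eta * be * (lam l * XH) + be^-1 * g1) / lam l.
  by field; rewrite !lt0r_neq0.
rewrite yE in md.
apply: le_trans md _.
rewrite -!addrA lerD2l.
(* Uniformity over the modes: [C1] and [C3] trade [lam l] for [rho2], [C2] for [rho]. *)
have C1 : 0 <= eta * (al * (lam l - rho2) / 2 * X ^+ 2).
  by rewrite mulr_ge0 ?(ltW eta_gt0) // mulr_ge0 ?sqr_ge0 // divr_ge0 //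
    mulr_ge0 ?(ltW al0) // subr_ge0.
have C2 : 0 <= eta * ((al / 2 + be) * (rho - lam l) * (X - XH) ^+ 2).
  rewrite mulr_ge0 ?(ltW eta_gt0) // mulr_ge0 ?sqr_ge0 // mulr_ge0 ?subr_ge0 //.
  by rewrite addr_ge0 ?divr_ge0 // ltW.
have C3 : eta * ((1 + 2 * k ^+ 2 * (be * lam l)) *
      ((g1 - g0) / (be * lam l * eta)) ^+ 2) <=
    ((be * rho2)^-2 + 2 * k ^+ 2 / (be * rho2)) / eta * (g1 - g0) ^+ 2.
  have -> : eta * ((1 + 2 * k ^+ 2 * (be * lam l)) *
      ((g1 - g0) / (be * lam l * eta)) ^+ 2) =
    ((be * lam l)^-2 + 2 * k ^+ 2 / (be * lam l)) / eta * (g1 - g0) ^+ 2.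
    by field; rewrite !lt0r_neq0.
  rewrite ler_wpM2r ?sqr_ge0 // ler_wpM2r ?invr_ge0 ?(ltW eta_gt0) //.
  have br : 0 < be * rho2 by rewrite mulr_gt0.
  have br_le : be * rho2 <= be * lam l by rewrite ler_pM2l.
  apply: lerD.
    rewrite -!exprVn lerXn2r ?nnegrE ?invr_ge0 ?(ltW b0) ?(ltW br) //.
    by rewrite lef_pV2 ?posrE.
  apply: ler_wpM2l; first by rewrite mulr_ge0 ?sqr_ge0.
  by rewrite lef_pV2 ?posrE.
lra.
Qed.

End ModesStep.

Lemma dot_polar (R : realType) (d : nat) (u w : 'rV[R]_d) :
  dot u w = (enorm u ^+ 2 + enorm w ^+ 2 - enorm (w - u) ^+ 2) / 2.
Proof.
rewrite !enorm_sqE -big_split -sumrB mulr_suml /=; apply: eq_bigr => j _.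
by rewrite !mxE; field.
Qed.

Lemma dotZr (R : realType) (d : nat) (c : R) (u w : 'rV[R]_d) :
  dot u (c *: w) = c * dot u w.
Proof.
by rewrite /dot mulr_sumr; apply: eq_bigr => j _; rewrite mxE mulrCA.
Qed.

Lemma dot_mean (R : realType) (n d : nat) (u : 'I_n -> 'rV[R]_d)
    (w : 'rV[R]_d) : (0 < n)%N -> n%:R * dot (mean u) w = \sum_i dot (u i) w.
Proof.
move=> n0; have nn0 : n%:R != 0 :> R by rewrite pnatr_eq0 -lt0n.
rewrite /dot exchange_big mulr_sumr /=; apply: eq_bigr => j _.
by rewrite mean_coord -mulr_suml !mulrA divff // mul1r.
Qed.

Lemma avgE (R : realType) (n d : nat) (f : 'I_n -> 'rV[R]_d -> R) y :
  (0 < n)%N -> n%:R * avg f y = \sum_i f i y.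
Proof.
move=> n0; have nn0 : n%:R != 0 :> R by rewrite pnatr_eq0 -lt0n.
by rewrite /avg mulrA divff // mul1r.
Qed.

Lemma meanB (R : realType) (n d : nat) (x y : 'I_n -> 'rV[R]_d) :
  mean (fun i => x i - y i) = mean x - mean y.
Proof. by rewrite /mean sumrB scalerBr. Qed.

Lemma meanD (R : realType) (n d : nat) (x y : 'I_n -> 'rV[R]_d) :
  mean (fun i => x i + y i) = mean x + mean y.
Proof. by rewrite /mean big_split scalerDr. Qed.

Lemma meanZ (R : realType) (n d : nat) (c : R) (x : 'I_n -> 'rV[R]_d) :
  mean (fun i => c *: x i) = c *: mean x.
Proof. by rewrite /mean -scaler_sumr !scalerA mulrC. Qed.

(** Where [eps1] comes from: its [5 / 4] of [Lf ^+ 2] is [3 / 4] from the gradient error in the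
    modes plus [1 / 2] from the inexact descent, and half of its [9 / 4 * be] survives as the gain.
    The term [eta / 2 * N] pays for the drift, the smoothness term and the mean part of the
    reserve. *)
Lemma one_step_arith (R : realFieldType) (eta z al be rho rho2 Lf K : R)
    (U U' nn f0 f1 fs X DLc DLn Pc Pn Dc Dn N F GF Hc Hn : R) :
  0 < eta -> 1 <= z -> 0 < be -> be <= al -> 0 <= rho -> 0 <= K ->
  eta * (8 * z + 7) * Lf ^+ 2 <=
    al / 2 * rho2 - 1 / 4 * (9 * be + 4 + 5 * Lf ^+ 2) ->
  eta * Lf <= 1 / 60 -> eta * (8 * z + 7) <= 1 / 12 ->
  Lf ^+ 2 * K <= 1 / 4 ->
  0 <= X -> 0 <= N -> DLc <= DLn -> Pc <= Pn -> Dc <= Dn ->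
  Pn <= Lf ^+ 2 * X -> Dn <= Lf ^+ 2 * eta ^+ 2 * N -> GF <= Pn ->
  Hn = Hc + N ->
  U' + (1 + 2 * z) * eta ^+ 2 * Hc <= U
    + eta * (- (al * rho2 / 2 - 9 / 8 * be - 1) * X
             + (al * rho / 2 + be * rho + 2 * be) * DLc
             + (3 / 4 + eta * (6 + 6 * z)) * Pc)
    + K / eta * Dc ->
  nn * f1 <= nn * f0 - eta / 2 * (F + N - GF) + Lf / 2 * eta ^+ 2 * N ->
  U' + nn * (f1 - fs) + (1 + 2 * z) * eta ^+ 2 * Hn
    + eta * (9 / 8 * be * X + F / 2)
  <= U + nn * (f0 - fs) + eta * (al * rho / 2 + be * rho + 2 * be) * DLn.
Proof.
move=> eta0 z1 be0 be_al rho0 K0 eta_Lf2 eta_Lf eta_z drift X0 N0 DL PcP DcD.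
move=> P1 D1 Gg HnE step desc.
have al0 : 0 < al := lt_le_trans be0 be_al.
have c0 : 0 <= al * rho / 2 + be * rho + 2 * be.
  by rewrite !addr_ge0 ?divr_ge0 ?mulr_ge0 ?(ltW al0) ?(ltW be0).
set c := al * rho / 2 + be * rho + 2 * be in c0 step *.
have F0 : eta * c * DLc <= eta * c * DLn.
  by rewrite ler_wpM2l // mulr_ge0 // ltW.
have F1 : eta * (3 / 4 + eta * (6 + 6 * z)) * Pc <=
    eta * (3 / 4 + eta * (6 + 6 * z)) * (Lf ^+ 2 * X).
  apply: ler_wpM2l; last exact: le_trans PcP P1.
  rewrite mulr_ge0 ?(ltW eta0) // addr_ge0 // mulr_ge0 ?(ltW eta0) //.
  by have := z1; lra.
have F2 : K / eta * Dc <= eta * N / 4.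
  apply: (@le_trans _ _ (K / eta * (Lf ^+ 2 * eta ^+ 2 * N))).
    by rewrite ler_wpM2l ?divr_ge0 ?(ltW eta0) // (le_trans DcD).
  have -> : K / eta * (Lf ^+ 2 * eta ^+ 2 * N) = Lf ^+ 2 * K * (eta * N).
    by field; exact: lt0r_neq0.
  rewrite [leRHS]mulrC -div1r; apply: ler_wpM2r => //.
  by rewrite mulr_ge0 // ltW.
have F3 : eta * X * (eta * (8 * z + 7) * Lf ^+ 2) <= eta * X *
    (al / 2 * rho2 - 1 / 4 * (9 * be + 4 + 5 * Lf ^+ 2)).
  by rewrite ler_wpM2l // mulr_ge0 // ltW.
have F3' : 0 <= eta * X * (eta * (2 * z + 1) * Lf ^+ 2).
  apply: mulr_ge0; first by rewrite mulr_ge0 // ltW.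
  apply: mulr_ge0; last exact: sqr_ge0.
  by rewrite mulr_ge0 ?(ltW eta0) //; lra.
have F4 : eta * N * (eta * (8 * z + 7)) <= eta * N * (1 / 12).
  by rewrite ler_wpM2l // mulr_ge0 // ltW.
have F4' : 0 <= eta * N * eta by rewrite !mulr_ge0 // ltW.
have F4'' : 0 <= eta * N by rewrite mulr_ge0 // ltW.
have F5 : eta * N * (eta * Lf) <= eta * N * (1 / 60).
  by rewrite ler_wpM2l // mulr_ge0 // ltW.
have F6 : eta * GF <= eta * (Lf ^+ 2 * X).
  by rewrite ler_wpM2l ?(ltW eta0) // (le_trans Gg).
rewrite HnE; clear - step desc F0 F1 F2 F3 F3' F4 F4' F4'' F5 F6; lra.
Qed.

Section OneStep.
Context (R : realType) (n d m : nat) (L : 'M[R]_n) (Q : 'M[R]_(m, n))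
  (lam : 'I_m -> R) (f : 'I_n -> 'rV[R]_d -> R).
Variables (fstar rho rho2 Lf eta z al be : R).
Let k := (al + be) / be ^+ 2.
Hypotheses (n_gt0 : (0 < n)%N) (f_diff : forall i x, differentiable (f i) x)
  (Lf_gt0 : 0 < Lf)
  (f_smooth : forall i x y,
     enorm (grad (f i) x - grad (f i) y) <= Lf * enorm (x - y))
  (col_sum : forall j, \sum_i L i j = 0)
  (rho2_gt0 : 0 < rho2) (lamP : forall l, rho2 <= lam l <= rho)
  (eig : forall l j, \sum_i Q l i * L i j = lam l * Q l j)
  (iso : forall z : 'I_n -> R, \sum_l (\sum_i Q l i * z i) ^+ 2 =
     \sum_i (z i - n%:R^-1 * \sum_j z j) ^+ 2)
  (eta_gt0 : 0 < eta) (z_ge1 : 1 <= z) (be_gt0 : 0 < be) (be_le : be <= al)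
  (al_ge : 9 / 2 * be <= al * rho2) (rho_ge0 : 0 <= rho)
  (eta_be : eta * be <= 1 / 100) (eta_le : eta <= 1 / 100)
  (eta_al : eta * (al * rho) * (8 * z + 7) <= 1 / 2)
  (eta_be_lam : forall l, eta * (6 + 6 * z) * (be * lam l) ^+ 2 <=
     be * lam l / 2 - 1)
  (eta_Lf2 : eta * (8 * z + 7) * Lf ^+ 2 <=
     al / 2 * rho2 - 1 / 4 * (9 * be + 4 + 5 * Lf ^+ 2))
  (eta_Lf : eta * Lf <= 1 / 60) (eta_z : eta * (8 * z + 7) <= 1 / 12)
  (drift : Lf ^+ 2 * ((be * rho2)^-2 + 2 * k ^+ 2 / (be * rho2)) <= 1 / 4).

Lemma grad_lipschitz_sq i x y :
  enorm (grad (f i) x - grad (f i) y) ^+ 2 <= Lf ^+ 2 * enorm (x - y) ^+ 2.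
Proof.
by rewrite -exprMn lerXn2r ?nnegrE ?mulr_ge0 ?sqrtr_ge0 // ltW.
Qed.

(* The dual equilibrium is -beta^-1 times the gradients at the average. *)
Definition lyapunov (x v : 'I_n -> 'rV[R]_d) : R :=
  modes_energy Q lam al be x (fun i => v i + be^-1 *: grad (f i) (mean x))
  + n%:R * (avg f (mean x) - fstar).

Lemma one_step (x xh v Lxh h : 'I_n -> 'rV[R]_d) :
  (Lxh = fun i => \sum_j L i j *: xh j) ->
  (h = fun i => al *: Lxh i + be *: v i + grad (f i) (x i)) ->
  \sum_i v i = 0 ->
  lyapunov (fun i => x i - eta *: h i) (fun i => v i + (eta * be) *: Lxh i)
  + (1 + 2 * z) * eta ^+ 2 * nsq h
  + eta * (9 / 8 * be * nsq (centered x)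
           + n%:R / 2 * enorm (grad (avg f) (mean x)) ^+ 2)
  <= lyapunov x v
   + eta * (al * rho / 2 + be * rho + 2 * be) * nsq (fun i => x i - xh i).
Proof.
move=> LxhE hE v0.
pose G i := grad (f i) (x i); pose g i := grad (f i) (mean x).
pose x' i := x i - eta *: h i; pose g' i := grad (f i) (mean x').
have mLxh : mean Lxh = 0.
  rewrite /mean LxhE exchange_big /= big1 ?scaler0 // => j _.
  by rewrite -scaler_suml col_sum scale0r.
have mv : mean v = 0 by rewrite /mean v0 scaler0.
(* The Laplacian and dual parts have zero mean, so the average iterate performs gradient descent
   with local gradients. *)
have mh : mean h = mean G.
  by rewrite hE !meanD !meanZ mLxh mv !scaler0 !add0r.
have mx' : mean x' = mean x - eta *: mean G.
  by rewrite /x' meanB meanZ mh.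
have gF : grad (avg f) (mean x) = mean g by rewrite grad_avg.
have step := modes_step rho2_gt0 lamP eig iso eta_gt0 z_ge1 be_gt0 be_le
  al_ge eta_be eta_le eta_al eta_be_lam x g g' LxhE hE.
have P1 : nsq (fun i => G i - g i) <= Lf ^+ 2 * nsq (centered x).
  rewrite /nsq mulr_sumr; apply: ler_sum => i _; exact: grad_lipschitz_sq.
have D1 : nsq (fun i => g' i - g i) <=
    Lf ^+ 2 * eta ^+ 2 * (n%:R * enorm (mean G) ^+ 2).
  have -> : Lf ^+ 2 * eta ^+ 2 * (n%:R * enorm (mean G) ^+ 2) =
      \sum_(i < n) Lf ^+ 2 * enorm (mean x' - mean x) ^+ 2.
    rewrite sumr_const card_ord -[RHS]mulr_natl.
    have -> : mean x' - mean x = (- eta) *: mean G.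
      by rewrite mx' addrAC subrr add0r scaleNr.
    by rewrite (enormZ_sq (- eta)); ring.
  by apply: ler_sum => i _; exact: grad_lipschitz_sq.
have Gg : n%:R * enorm (mean G - mean g) ^+ 2 <= nsq (fun i => G i - g i).
  by rewrite -meanB; exact: enorm_mean_le.
have Hn := nsq_centered h n_gt0; rewrite mh in Hn.
have desc : n%:R * avg f (mean x') <= n%:R * avg f (mean x)
    - eta / 2 * (n%:R * enorm (mean g) ^+ 2 + n%:R * enorm (mean G) ^+ 2
                 - n%:R * enorm (mean G - mean g) ^+ 2)
    + Lf / 2 * eta ^+ 2 * (n%:R * enorm (mean G) ^+ 2).
  have D i : f i (mean x') <= f i (mean x) + dot (g i) (mean x' - mean x)
      + Lf / 2 * enorm (mean x' - mean x) ^+ 2.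
    by apply: descent_lemma => //; exact: f_smooth.
  have : \sum_i f i (mean x') <= \sum_i (f i (mean x) +
      dot (g i) (mean x' - mean x) + Lf / 2 * enorm (mean x' - mean x) ^+ 2).
    by apply: ler_sum => i _; exact: D.
  rewrite !big_split /= sumr_const card_ord -[X in _ + X]mulr_natl.
  rewrite -dot_mean // -!avgE //.
  have -> : mean x' - mean x = (- eta) *: mean G.
    by rewrite mx' addrAC subrr add0r scaleNr.
  rewrite (dotZr (- eta)) (enormZ_sq (- eta)) dot_polar.
  move=> le_f; apply: le_trans le_f _.
  by rewrite le_eqVlt; apply/orP; left; apply/eqP; field.
rewrite gF /lyapunov.
have -> : n%:R / 2 * enorm (mean g) ^+ 2 = n%:R * enorm (mean g) ^+ 2 / 2.
  by field.
have K0 : 0 <= (be * rho2)^-2 + 2 * k ^+ 2 / (be * rho2).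
  have br : 0 <= be * rho2 by rewrite mulr_ge0 // ltW.
  by apply: addr_ge0; rewrite ?invr_ge0 ?exprn_ge0 // divr_ge0 // mulr_ge0 ?sqr_ge0.
have N0 : 0 <= n%:R * enorm (mean G) ^+ 2 by rewrite mulr_ge0 ?sqr_ge0.
exact: (one_step_arith fstar eta_gt0 z_ge1 be_gt0 be_le rho_ge0 K0 eta_Lf2
  eta_Lf eta_z drift (nsq_ge0 _) N0 (nsq_centered_le _ n_gt0)
  (nsq_centered_le _ n_gt0) (nsq_centered_le _ n_gt0) P1 D1 Gg Hn step desc).
Qed.

End OneStep.

(** * Expectations along the run *)

Section MeasurableVectors.
Context (R : realType) (d : nat) (dT : measure_display) (T : measurableType dT).
Implicit Types g h : T -> 'rV[R]_d.

Definition vmeasurable g := measurable_fun setT (g : T -> borelRd R d).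

Lemma vmeasurable_cst (u : 'rV[R]_d) : vmeasurable (fun=> u).
Proof. exact: measurable_cst. Qed.

Lemma vmeasurableD g h : vmeasurable g -> vmeasurable h ->
  vmeasurable (fun t => g t + h t).
Proof.
move=> /measurable_borelRdP mg /measurable_borelRdP mh.
apply/measurable_borelRdP => j; under eq_fun do rewrite mxE.
by apply: measurable_funD.
Qed.

Lemma vmeasurableZ (c : R) g : vmeasurable g -> vmeasurable (fun t => c *: g t).
Proof.
move=> /measurable_borelRdP mg.
apply/measurable_borelRdP => j; under eq_fun do rewrite mxE.
by apply: measurable_funM.
Qed.

Lemma vmeasurableB g h : vmeasurable g -> vmeasurable h ->
  vmeasurable (fun t => g t - h t).
Proof.
move=> mg mh; under [X in vmeasurable X]eq_fun do rewrite -scaleN1r.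
by apply: vmeasurableD => //; exact: vmeasurableZ.
Qed.

Lemma vmeasurable_sum (I : finType) (g : I -> T -> 'rV[R]_d) :
  (forall i, vmeasurable (g i)) -> vmeasurable (fun t => \sum_i g i t).
Proof.
move=> mg; apply/measurable_borelRdP => j; under eq_fun do rewrite summxE.
by apply: measurable_sum => i; have /measurable_borelRdP := mg i.
Qed.

Lemma vmeasurable_mean (n : nat) (g : 'I_n -> T -> 'rV[R]_d) :
  (forall i, vmeasurable (g i)) -> vmeasurable (fun t => mean (fun i => g i t)).
Proof. by move=> mg; apply: vmeasurableZ; exact: vmeasurable_sum. Qed.

Lemma measurable_coord_comp g j : vmeasurable g ->
  measurable_fun setT (fun t => g t ord0 j).
Proof. by move=> /measurable_borelRdP. Qed.

Lemma continuous_comp_measurable (F : 'rV[R]_d -> R) g :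
  continuous F -> vmeasurable g -> measurable_fun setT (fun t => F (g t)).
Proof.
move=> cF mg; have mF : measurable_fun setT (F : borelRd R d -> R).
  apply: (measurability _ (RGenOpens.measurableE R)) => _ [_ [a [b ->] <-]].
  rewrite setTI; apply: sub_sigma_algebra.
  by move/continuousP : cF; apply; exact: interval_open.
exact: (measurableT_comp mF mg).
Qed.

(** Makes the gradients measurable: Lipschitz for the Euclidean norm implies continuous for the max
    norm, whose open sets generate the Borel sets. *)
Lemma lipschitz_comp_measurable (F : 'rV[R]_d -> 'rV[R]_d) (M : R) g : 0 < M ->
  (forall x y, enorm (F x - F y) <= M * enorm (x - y)) ->
  vmeasurable g -> vmeasurable (fun t => F (g t)).
Proof.
move=> M0 lip mg.
have cF : continuous F.
  move=> x B /nbhs_ballP [e /= e0 eB].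
  (* The factor [d.+1] is nonzero even for [d = 0], and [d < d.+1 ^ 2] covers the loss between the
     two norms. *)
  pose dlt := e / (M * (d.+1)%:R).
  have dlt0 : 0 < dlt by rewrite divr_gt0 // mulr_gt0.
  apply/nbhs_ballP; exists dlt => //= y [_ xyb]; apply: eB.
  have xy j : `|x ord0 j - y ord0 j| < dlt by exact: xyb.
  have sq : enorm (F x - F y) ^+ 2 < e ^+ 2.
    apply: (@le_lt_trans _ _ (M ^+ 2 * (d%:R * dlt ^+ 2))).
      apply: (@le_trans _ _ ((M * enorm (x - y)) ^+ 2)).
        by rewrite lerXn2r ?nnegrE ?mulr_ge0 ?sqrtr_ge0 // ltW.
      rewrite exprMn ler_wpM2l ?sqr_ge0 // enorm_sqE.
      have -> : d%:R * dlt ^+ 2 = \sum_(j < d) dlt ^+ 2.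
        by rewrite sumr_const card_ord mulr_natl.
      apply: ler_sum => j _; rewrite !mxE.
      rewrite -(real_normK (num_real (x ord0 j - y ord0 j))).
      apply: lerXn2r; rewrite ?nnegrE ?normr_ge0 ?(ltW dlt0) //.
      exact: ltW (xy j).
    have -> : e = M * (d.+1%:R * dlt) by rewrite /dlt; field; rewrite !lt0r_neq0.
    rewrite [ltRHS]exprMn ltr_pM2l ?exprn_gt0 // [ltRHS]exprMn ltr_pM2r ?exprn_gt0 //.
    by rewrite -natrX ltr_nat expnS expn1 leq_pmulr.
  split=> // i j; rewrite (ord1 i) /ball /=.
  rewrite -(ltr_pXn2r (ltn0Sn 1)) ?nnegrE // ?ltW //.
  apply: le_lt_trans sq; rewrite real_normK ?num_real // enorm_sqE.
  by rewrite (bigD1 j) //= !mxE lerDl sumr_ge0 // => k _; exact: sqr_ge0.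
have mF : measurable_fun setT (F : borelRd R d -> borelRd R d).
  apply: (@measurability _ _ (borelRd R d) (borelRd R d) setT F (@open _) erefl).
  move=> _ [A oA <-]; rewrite setTI; apply: sub_sigma_algebra.
  by move/continuousP : cF; apply.
exact: (measurableT_comp mF mg).
Qed.

End MeasurableVectors.

Section Adapted.
Context (R : realType) (n d : nat) (dW : measure_display)
  (W : measurableType dW) (mu : probability W R)
  (C : W -> 'rV[R]_d -> 'rV[R]_d) (phi r : R)
  (L : 'M[R]_n) (f : 'I_n -> 'rV[R]_d -> R) (Lf alpha beta eta psi sigma : R)
  (dO : measure_display) (Omega : measurableType dO) (P : probability Omega R)
  (xi xih : nat -> 'I_n -> Omega -> W) (x0 : 'I_n -> 'rV[R]_d)
  (a b x v q e qh : nat -> 'I_n -> Omega -> 'rV[R]_d).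
Hypotheses (phi_le1 : phi <= 1) (C_comp : compressor mu C phi r)
  (Lf_gt0 : 0 < Lf)
  (f_smooth : forall i x y,
     enorm (grad (f i) x - grad (f i) y) <= Lf * enorm (x - y))
  (seeds : fresh_seeds P mu xi xih)
  (run : forall w : Omega,
     error_feedback_run C L f alpha beta eta psi sigma x0
       (fun k i => xi k i w) (fun k i => xih k i w)
       (fun k i => a k i w) (fun k i => b k i w) (fun k i => x k i w)
       (fun k i => v k i w) (fun k i => q k i w) (fun k i => e k i w)
       (fun k i => qh k i w)).

Definition seed (s : bool * (nat * 'I_n)) : Omega -> W :=
  if s.1 then xih s.2.1 s.2.2 else xi s.2.1 s.2.2.

(** The inequality is strict: the state at time [k] is adapted to [past k], for which the seeds of
    step [k] are still fresh. *)
Definition past (k : nat) : pred (bool * (nat * 'I_n)) := fun s => (s.2.1 < k)%N.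

Definition adapted k (g : Omega -> 'rV[R]_d) :=
  vmeasurable (g : sub_sigma seed (past k) -> 'rV[R]_d).

Lemma measurable_seed s : measurable_fun setT (seed s).
Proof. by have [ms _ _] := seeds; exact: ms. Qed.

Lemma adapted_mono k g : adapted k g -> adapted k.+1 g.
Proof.
apply: measurable_sub_sigma_mono => s; rewrite /past !unfold_in.
exact: ltnW.
Qed.

Lemma adapted_vmeasurable k g : adapted k g -> vmeasurable g.
Proof. by apply: measurable_sub_sigma_full; exact: measurable_seed. Qed.

Lemma adapted_compress k c i g : adapted k g ->
  adapted k.+1 (fun w => C (seed (c, (k, i)) w) (g w)).
Proof.
move=> /adapted_mono mg; have [mC _] := C_comp.
pose T := sub_sigma seed (past k.+1).
have mG : measurable_fun setT
    (fun w : T => (seed (c, (k, i)) w, g w : borelRd R d)).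
  apply: measurable_fun_pair => //.
  by apply: measurable_sub_sigma_gen; rewrite /past /=.
exact: (measurableT_comp mC mG).
Qed.

Lemma qE k i w : q k i w = C (seed (false, (k, i)) w) (x k i w - a k i w).
Proof.
case: k => [|k]; last by rewrite (run_q (run w)).
by rewrite (run_q0 (run w)) (run_a0 (run w)) subr0.
Qed.

(* At time 0, qh reuses the seed of q. *)
Lemma qhE k i w : qh k i w =
  C (seed (k != 0%N, (k, i)) w) (sigma *: e k i w + x k i w - a k i w).
Proof.
case: k => [|k]; last by rewrite (run_qh (run w)).
rewrite (run_qh0 (run w)) qE (run_a0 (run w)) (run_e0 (run w)).
by rewrite scaler0 add0r.
Qed.

Lemma adapted_grad k i g : adapted k g -> adapted k (fun w => grad (f i) (g w)).
Proof. by apply: lipschitz_comp_measurable Lf_gt0 _; exact: f_smooth. Qed.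

Lemma run_adapted k i :
  [/\ adapted k (a k i), adapted k (b k i), adapted k (x k i),
      adapted k (v k i) & adapted k (e k i)] /\
  (adapted k.+1 (q k i) /\ adapted k.+1 (qh k i)).
Proof.
(* Outputs of step [m] follow from its state, and are needed for all agents at once: the next state
   of one agent reads the outputs of the others. *)
have out m : (forall i, [/\ adapted m (a m i), adapted m (b m i),
      adapted m (x m i), adapted m (v m i) & adapted m (e m i)]) ->
    forall i, adapted m.+1 (q m i) /\ adapted m.+1 (qh m i).
  move=> H l; have [ma _ mx _ me] := H l.
  split; [rewrite (funext (qE m l))|rewrite (funext (qhE m l))];
    apply: adapted_compress; apply: vmeasurableB => //.
  by apply: vmeasurableD => //; exact: vmeasurableZ.
suff H : forall i, [/\ adapted k (a k i), adapted k (b k i),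
      adapted k (x k i), adapted k (v k i) & adapted k (e k i)].
  by split; [exact: H|exact: out].
elim: k {i} => [|k IH] i.
  have -> : a 0%N i = (fun=> 0) by apply/funext => w; exact: (run_a0 (run w)).
  have -> : b 0%N i = (fun=> 0) by apply/funext => w; exact: (run_b0 (run w)).
  have -> : x 0%N i = (fun=> x0 i) by apply/funext => w; exact: (run_x0 (run w)).
  have -> : v 0%N i = (fun=> 0) by apply/funext => w; exact: (run_v0 (run w)).
  have -> : e 0%N i = (fun=> 0) by apply/funext => w; exact: (run_e0 (run w)).
  by split; exact: vmeasurable_cst.
have mq l := (out k IH l).1; have mqh l := (out k IH l).2.
have {IH out}IH l : [/\ adapted k.+1 (a k l), adapted k.+1 (b k l),
      adapted k.+1 (x k l), adapted k.+1 (v k l) & adapted k.+1 (e k l)].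
  have [h1 h2 h3 h4 h5] := IH l.
  by split; [exact: adapted_mono h1|exact: adapted_mono h2|exact: adapted_mono h3|
    exact: adapted_mono h4|exact: adapted_mono h5].
have [ma mb mx mv me] := IH i; have mqi := mq i; have mqhi := mqh i.
have mdir : adapted k.+1 (fun w => a k i w - b k i w + \sum_j L i j *: qh k j w).
  apply: vmeasurableD; first exact: vmeasurableB.
  by apply: vmeasurable_sum => j; exact: (vmeasurableZ _ (mqh j)).
split.
- have -> : a k.+1 i = (fun w => a k i w + psi *: q k i w).
    by apply/funext => w; exact: (run_a (run w)).
  by apply: vmeasurableD => //; apply: vmeasurableZ.
- have -> : b k.+1 i = (fun w =>
      b k i w + psi *: (q k i w - \sum_(j < n) L i j *: q k j w)).
    by apply/funext => w; exact: (run_b (run w)).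
  apply: vmeasurableD => //; apply: vmeasurableZ; apply: vmeasurableB => //.
  by apply: vmeasurable_sum => j; exact: (vmeasurableZ _ (mq j)).
- have -> : x k.+1 i = (fun w => x k i w - (eta * alpha) *: (a k i w - b k i w +
      \sum_(j < n) L i j *: qh k j w) -
      eta *: (beta *: v k i w + grad (f i) (x k i w))).
    by apply/funext => w; exact: (run_x (run w)).
  apply: vmeasurableB; first by apply: vmeasurableB => //; exact: vmeasurableZ.
  apply: vmeasurableZ; apply: vmeasurableD; first exact: vmeasurableZ.
  exact: adapted_grad.
- have -> : v k.+1 i = (fun w => v k i w + (eta * beta) *: (a k i w - b k i w +
      \sum_(j < n) L i j *: qh k j w)).
    by apply/funext => w; exact: (run_v (run w)).
  by apply: vmeasurableD => //; apply: vmeasurableZ.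
- have -> : e k.+1 i = (fun w => sigma *: e k i w + x k i w - a k i w - qh k i w).
    by apply/funext => w; exact: (run_e (run w)).
  apply: vmeasurableB => //; apply: vmeasurableB => //.
  by apply: vmeasurableD => //; apply: vmeasurableZ.
Qed.

Lemma compress_integral_le k c i g : adapted k g ->
  (\int[P]_w (enorm (r^-1 *: C (seed (c, (k, i)) w) (g w) - g w) ^+ 2)%:E
    <= (1 - phi)%:E * \int[P]_w (enorm (g w) ^+ 2)%:E)%E.
Proof.
move=> mg; have [ms law indep] := seeds.
apply: (compressor_integral_le (mu := mu)) => //.
- exact: measurable_seed.
- exact: adapted_vmeasurable mg.
move=> A B mA mB; rewrite setIC.
rewrite (@sub_sigma_indep _ _ _ _ _ R P seed (past k)) //.
- by rewrite (law (c, (k, i))) // muleC.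
- by have := mg measurableT B mB; rewrite setTI.
- by rewrite /past /= ltnn.
Qed.

End Adapted.

Section Expectation.
Context (R : realType) (dO : measure_display) (Omega : measurableType dO)
  (P : probability Omega R).
Implicit Types g h : Omega -> R.

Definition nnmeasurable g := measurable_fun setT g /\ forall w, 0 <= g w.

Definition mass g : \bar R := (\int[P]_w (g w)%:E)%E.

Lemma mass_ge0 g : nnmeasurable g -> (0 <= mass g)%E.
Proof. by move=> [_ g0]; apply: integral_ge0 => w _; rewrite lee_fin. Qed.

Lemma nnmeasurableD g h : nnmeasurable g -> nnmeasurable h ->
  nnmeasurable (fun w => g w + h w).
Proof.
by move=> [mg g0] [mh h0]; split=> [|w]; [exact: measurable_funD|exact: addr_ge0].
Qed.

Lemma nnmeasurableZ (c : R) g : 0 <= c -> nnmeasurable g ->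
  nnmeasurable (fun w => c * g w).
Proof.
by move=> c0 [mg g0]; split=> [|w]; [exact: measurable_funM|exact: mulr_ge0].
Qed.

Lemma nnmeasurable_sum (I : finType) (g : I -> Omega -> R) :
  (forall i, nnmeasurable (g i)) -> nnmeasurable (fun w => \sum_i g i w).
Proof.
move=> mg; split=> [|w]; last by apply: sumr_ge0 => i _; exact: (mg i).2.
by apply: measurable_sum => i; exact: (mg i).1.
Qed.

Lemma le_mass g h : nnmeasurable g -> nnmeasurable h -> (forall w, g w <= h w) ->
  (mass g <= mass h)%E.
Proof.
move=> [mg g0] [mh h0] gh; apply: ge0_le_integral => //.
- by move=> w _; rewrite lee_fin.
- exact/measurable_EFinP.
- exact/measurable_EFinP.
- by move=> w _; rewrite lee_fin.
Qed.

Lemma massD g h : nnmeasurable g -> nnmeasurable h ->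
  mass (fun w => g w + h w) = (mass g + mass h)%E.
Proof.
move=> [mg g0] [mh h0]; rewrite /mass -ge0_integralD //.
- by move=> w _; rewrite lee_fin.
- exact/measurable_EFinP.
- by move=> w _; rewrite lee_fin.
- exact/measurable_EFinP.
Qed.

Lemma massZ (c : R) g : 0 <= c -> nnmeasurable g ->
  mass (fun w => c * g w) = (c%:E * mass g)%E.
Proof.
move=> c0 [mg g0]; rewrite /mass -ge0_integralZl //.
- exact/measurable_EFinP.
- by move=> w _; rewrite lee_fin.
Qed.

Lemma mass_sum (I : finType) (g : I -> Omega -> R) :
  (forall i, nnmeasurable (g i)) ->
  mass (fun w => \sum_i g i w) = (\sum_i mass (g i))%E.
Proof.
move=> mg; rewrite /mass -ge0_integral_sum //.
- by apply: eq_integral => w _; rewrite sumEFin.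
- by move=> i; apply/measurable_EFinP; exact: (mg i).1.
- by move=> i w _; rewrite lee_fin; exact: (mg i).2.
Qed.

Lemma mass_cst (c : R) : mass (fun=> c) = c%:E.
Proof. by rewrite /mass integral_cst //= probability_setT mule1. Qed.

Lemma mass_le_combination (c c' k : R) f g h :
  nnmeasurable f -> nnmeasurable g -> nnmeasurable h ->
  0 <= c -> 0 <= c' -> 0 <= k -> (forall w, h w <= c * f w + c' * g w) ->
  (mass g <= k%:E * mass f)%E -> (mass h <= (c + c' * k)%:E * mass f)%E.
Proof.
move=> mf mg mh c0 c'0 k0 hfg gf.
have mcf := nnmeasurableZ c0 mf; have mcg := nnmeasurableZ c'0 mg.
apply: le_trans (le_mass mh (nnmeasurableD mcf mcg) hfg) _.
rewrite massD // !massZ // EFinD ge0_muleDl ?lee_fin ?mulr_ge0 //.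
by rewrite leeD2l // EFinM -muleA lee_wpmul2l ?lee_fin.
Qed.

Lemma mass_sum_le (I : finType) (k : R) (f g : I -> Omega -> R) :
  (forall i, nnmeasurable (f i)) -> (forall i, nnmeasurable (g i)) ->
  (forall i, (mass (g i) <= k%:E * mass (f i))%E) ->
  (mass (fun w => \sum_i g i w)%R <=
    k%:E * mass (fun w => \sum_i f i w)%R)%E.
Proof.
move=> mf mg gf; rewrite !mass_sum // ge0_sume_distrr; last first.
  by move=> i _; exact: mass_ge0.
by apply: lee_sum => i _; exact: gf.
Qed.

(** Linear arithmetic when all masses are finite. An infinite mass of [Z], [Y] or [E] makes the
    right side [+oo], for [E] because [0 < tau]; if these three are finite, the bounds make those of
    [Yq] and [E'] finite too. *)
Lemma expected_descent (c1 c2 c3 d0 d1 d2 tau : R) Z Y E Yq E' V' :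
  nnmeasurable Z -> nnmeasurable Y -> nnmeasurable E -> nnmeasurable Yq ->
  nnmeasurable E' -> nnmeasurable V' ->
  0 <= c1 -> 0 <= c2 -> 0 <= c3 -> 0 <= d0 -> 0 <= d1 -> 0 <= d2 -> 0 < tau ->
  (forall w, V' w <= Z w + c1 * Yq w + c2 * E' w + c3 * E w) ->
  (mass Yq <= d0%:E * mass Y)%E ->
  (mass E' <= d1%:E * mass E + d2%:E * mass Y)%E ->
  c1 * d0 + c2 * d2 <= 1 -> c2 * d1 + c3 <= tau ->
  (mass V' <= mass (fun w => Z w + Y w + tau * E w)%R)%E.
Proof.
move=> mZ mY mE mYq mE' mV' c10 c20 c30 d00 d10 d20 tau0 VZ Yqle E'le Ycoef Ecoef.
have mtE := nnmeasurableZ (ltW tau0) mE.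
have mZY := nnmeasurableD mZ mY.
have mc1 := nnmeasurableZ c10 mYq; have mc2 := nnmeasurableZ c20 mE'.
have mc3 := nnmeasurableZ c30 mE; have mZc1 := nnmeasurableD mZ mc1.
have mZc2 := nnmeasurableD mZc1 mc2.
apply: le_trans (le_mass mV' (nnmeasurableD mZc2 mc3) VZ) _.
rewrite !massD // !massZ //; last exact: ltW.
have := mass_ge0 mZ; have := mass_ge0 mY; have := mass_ge0 mE.
have := mass_ge0 mYq; have := mass_ge0 mE'.
have tauE0 : (0 <= tau%:E * mass E)%E.
  by rewrite mule_ge0 ?mass_ge0 // lee_fin ltW.
have neqNy (u : \bar R) : (0 <= u)%E -> u != -oo%E.
  by move=> u0; rewrite gt_eqF // (lt_le_trans _ u0).
case: (mass Z) => [Z0| |] //; last first.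
  move=> _ _ _ Y0 _; rewrite [leRHS](_ : _ = +oo%E) ?leey //.
  by rewrite -addeA addye // neqNy // adde_ge0.
case: (mass Y) Yqle E'le => [Y0| |] // Yqle E'le; last first.
  move=> *; rewrite [leRHS](_ : _ = +oo%E) ?leey //.
  by rewrite addey // addye // neqNy.
clear tauE0; case: (mass E) E'le => [E0| |] // E'le; last first.
  move=> *; rewrite [leRHS](_ : _ = +oo%E) ?leey //.
  by rewrite gt0_muley ?lte_fin // addey.
case: (mass Yq) Yqle => [Yq0| |] // Yqle.
case: (mass E') E'le => [E'0| |] // E'le.
move: Yqle E'le; rewrite -!EFinM -!EFinD !lee_fin => Yqle E'le E'p Yqp Ep Yp Zp.
have h1 := ler_wpM2l c10 Yqle; have h2 := ler_wpM2l c20 E'le.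
have h3 := ler_wpM2r Yp Ycoef; have h4 := ler_wpM2r Ep Ecoef.
clear - h1 h2 h3 h4; lra.
Qed.

End Expectation.

Lemma enorm_young (R : realType) (d : nat) (t : R) (u w : 'rV[R]_d) : 0 < t ->
  enorm (u + w) ^+ 2 <= (1 + t) * enorm u ^+ 2 + (1 + t^-1) * enorm w ^+ 2.
Proof.
move=> t0; rewrite !enorm_sqE !mulr_sumr -big_split; apply: ler_sum => j _ /=.
rewrite mxE; set p := u ord0 j; set q := w ord0 j; rewrite -subr_ge0.
have -> : (1 + t) * p ^+ 2 + (1 + t^-1) * q ^+ 2 - (p + q) ^+ 2 =
    (t * p - q) ^+ 2 / t by field; exact: lt0r_neq0.
by rewrite divr_ge0 ?sqr_ge0 // ltW.
Qed.

Lemma enormN_sq (R : realType) (d : nat) (u : 'rV[R]_d) :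
  enorm (- u) ^+ 2 = enorm u ^+ 2.
Proof. by rewrite -scaleN1r enormZ_sq sqrrN expr1n mul1r. Qed.

Lemma enorm_convex (R : realType) (d : nat) (t : R) (u w : 'rV[R]_d) :
  0 <= t <= 1 ->
  enorm ((1 - t) *: u + t *: w) ^+ 2 <=
  (1 - t) * enorm u ^+ 2 + t * enorm w ^+ 2.
Proof.
move=> /andP[t0 t1]; rewrite !enorm_sqE !mulr_sumr -big_split.
apply: ler_sum => j _ /=; rewrite !mxE -subr_ge0.
set p := u ord0 j; set q := w ord0 j.
have -> : (1 - t) * p ^+ 2 + t * q ^+ 2 - ((1 - t) * p + t * q) ^+ 2 =
    t * (1 - t) * (p - q) ^+ 2 by ring.
by rewrite mulr_ge0 ?sqr_ge0 // mulr_ge0 // subr_ge0.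
Qed.

Lemma nsq_young (R : realType) (n d : nat) (t : R) (u w : 'I_n -> 'rV[R]_d) :
  0 < t ->
  nsq (fun i => u i - w i) <= (1 + t) * nsq u + (1 + t^-1) * nsq w.
Proof.
move=> t0; rewrite /nsq !mulr_sumr -big_split; apply: ler_sum => i _ /=.
by rewrite -(enormN_sq (w i)); exact: enorm_young.
Qed.

Lemma nsqZ (R : realType) (n d : nat) (c : R) (u : 'I_n -> 'rV[R]_d) :
  nsq (fun i => c *: u i) = c ^+ 2 * nsq u.
Proof.
by rewrite /nsq mulr_sumr; apply: eq_bigr => i _; rewrite enormZ_sq.
Qed.

Lemma potential_step_arith (R : realFieldType)
    (eta c s z tau sg Z Z' Y' E E' Yq H G dl : R) :
  Z' + (1 + 2 * z) * eta ^+ 2 * H + eta * G <= Z + eta * c * dl ->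
  Y' <= (1 + s / 2) * Yq + (1 + 2 * z) * eta ^+ 2 * H ->
  eta * c * dl <= eta * c * (2 * E' + 2 * sg ^+ 2 * E) ->
  Z' + Y' + tau * E' + eta * G <= Z + (1 + s / 2) * Yq
    + (tau + 2 * eta * c) * E' + (2 * eta * c * sg ^+ 2) * E.
Proof. by lra. Qed.

(** * Descent of the potential and telescoping *)

Section Convergence.
Context (R : realType) (n d m : nat) (dW : measure_display)
  (W : measurableType dW) (mu : probability W R)
  (C : W -> 'rV[R]_d -> 'rV[R]_d) (phi r : R)
  (L : 'M[R]_n) (Q : 'M[R]_(m, n)) (lam : 'I_m -> R)
  (f : 'I_n -> 'rV[R]_d -> R)
  (Lf fstar rho rho2 alpha beta eta psi sigma r1 tau0 : R)
  (dO : measure_display) (Omega : measurableType dO) (P : probability Omega R)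
  (xi xih : nat -> 'I_n -> Omega -> W) (x0 : 'I_n -> 'rV[R]_d)
  (a b x v q e qh : nat -> 'I_n -> Omega -> 'rV[R]_d).
Let s := phi * psi * r.
Let z := s^-1.
Let c := alpha * rho / 2 + beta * rho + 2 * beta.
Let k2 := (alpha + beta) / beta ^+ 2.
Hypotheses (phi_le1 : phi <= 1) (C_comp : compressor mu C phi r)
  (Lf_gt0 : 0 < Lf)
  (f_smooth : forall i x y,
     enorm (grad (f i) x - grad (f i) y) <= Lf * enorm (x - y))
  (seeds : fresh_seeds P mu xi xih)
  (run : forall w : Omega,
     error_feedback_run C L f alpha beta eta psi sigma x0
       (fun k i => xi k i w) (fun k i => xih k i w)
       (fun k i => a k i w) (fun k i => b k i w) (fun k i => x k i w)
       (fun k i => v k i w) (fun k i => q k i w) (fun k i => e k i w)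
       (fun k i => qh k i w)).
Hypotheses (n_gt0 : (0 < n)%N) (f_diff : forall i x, differentiable (f i) x)
  (fstar_le : forall y, fstar <= avg f y)
  (col_sum : forall j, \sum_i L i j = 0)
  (rho2_gt0 : 0 < rho2) (lamP : forall l, rho2 <= lam l <= rho)
  (eig : forall l j, \sum_i Q l i * L i j = lam l * Q l j)
  (iso : forall z : 'I_n -> R, \sum_l (\sum_i Q l i * z i) ^+ 2 =
     \sum_i (z i - n%:R^-1 * \sum_j z j) ^+ 2)
  (s_gt0 : 0 < s) (psir_gt0 : 0 < psi * r) (psir_le1 : psi * r <= 1)
  (r_gt0 : 0 < r)
  (eta_gt0 : 0 < eta) (z_ge1 : 1 <= z) (beta_gt0 : 0 < beta)
  (beta_le : beta <= alpha)
  (alpha_ge : 9 / 2 * beta <= alpha * rho2) (rho_ge0 : 0 <= rho)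
  (eta_beta : eta * beta <= 1 / 100) (eta_le : eta <= 1 / 100)
  (eta_alpha : eta * (alpha * rho) * (8 * z + 7) <= 1 / 2)
  (eta_beta_lam : forall l, eta * (6 + 6 * z) * (beta * lam l) ^+ 2 <=
     beta * lam l / 2 - 1)
  (eta_Lf2 : eta * (8 * z + 7) * Lf ^+ 2 <=
     alpha / 2 * rho2 - 1 / 4 * (9 * beta + 4 + 5 * Lf ^+ 2))
  (eta_Lf : eta * Lf <= 1 / 60) (eta_z : eta * (8 * z + 7) <= 1 / 12)
  (drift : Lf ^+ 2 * ((beta * rho2)^-2 + 2 * k2 ^+ 2 / (beta * rho2)) <= 1 / 4)
  (r1_gt1 : 1 < r1) (tau0_gt0 : 0 < tau0)
  (tau1_cond : (tau0 + 2 * eta * c) * (cr0 phi r * cr2 r1) <= eps7 phi r psi)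
  (tau2_cond : tau0 * (cr0 phi r * r1 * sigma ^+ 2) +
     2 * eta * c * ((cr0 phi r * r1 + 1) * sigma ^+ 2) <= tau0).

Definition dirL k w i : 'rV[R]_d := \sum_j L i j *: (a k j w + qh k j w).

(** Both sides start at 0 and grow at each step by [psi] times [L] applied to [q]. *)
Lemma run_laplacian k w i : a k i w - b k i w = \sum_j L i j *: a k j w.
Proof.
elim: k i => [|k IH] i.
  rewrite (run_a0 (run w)) (run_b0 (run w)) subr0 big1 // => j _.
  by rewrite (run_a0 (run w)) scaler0.
rewrite (run_a (run w)) (run_b (run w)).
have -> : \sum_j L i j *: a k.+1 j w =
    \sum_j L i j *: a k j w + psi *: \sum_j L i j *: q k j w.
  rewrite scaler_sumr -big_split; apply: eq_bigr => j _ /=.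
  by rewrite (run_a (run w)) scalerDr !scalerA mulrC.
rewrite -IH; move: (\sum_j _) => S.
by apply/rowP => j; rewrite !mxE; ring.
Qed.

Lemma dirLE k w i :
  a k i w - b k i w + \sum_j L i j *: qh k j w = dirL k w i.
Proof.
rewrite run_laplacian -big_split; apply: eq_bigr => j _ /=.
by rewrite scalerDr.
Qed.

Lemma run_v_sum k w : \sum_i v k i w = 0.
Proof.
elim: k => [|k IH]; first by rewrite big1 // => i _; rewrite (run_v0 (run w)).
under eq_bigr do rewrite (run_v (run w)) dirLE.
rewrite big_split /= IH add0r -scaler_sumr /dirL exchange_big /= big1 ?scaler0 //.
by move=> j _; rewrite -scaler_suml col_sum scale0r.
Qed.

Definition direction k w i : 'rV[R]_d :=
  alpha *: dirL k w i + beta *: v k i w + grad (f i) (x k i w).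

Lemma run_xE k w i : x k.+1 i w = x k i w - eta *: direction k w i.
Proof.
rewrite (run_x (run w)) dirLE /direction; move: (dirL k w i) => S.
by apply/rowP => j; rewrite !mxE; ring.
Qed.

Definition lyap k w :=
  lyapunov Q lam f fstar alpha beta (fun i => x k i w) (fun i => v k i w).
Definition gap k w := nsq (fun i => x k i w - a k i w).
Definition residual k w :=
  nsq (fun i => x k i w - a k i w - psi *: q k i w).
Definition feedback k w := nsq (fun i => e k i w).
Definition gain k w := 9 / 8 * beta * nsq (centered (fun i => x k i w))
  + n%:R / 2 * enorm (grad (avg f) (mean (fun i => x k i w))) ^+ 2.

Lemma potential_step k w :
  lyap k.+1 w + gap k.+1 w + tau0 * feedback k.+1 w + eta * gain k w <=
  lyap k w + (1 + s / 2) * residual k w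
  + (tau0 + 2 * eta * c) * feedback k.+1 w
  + (2 * eta * c * sigma ^+ 2) * feedback k w.
Proof.
have step := one_step fstar n_gt0 f_diff Lf_gt0 f_smooth col_sum rho2_gt0 lamP
  eig iso eta_gt0 z_ge1 beta_gt0 beta_le alpha_ge rho_ge0 eta_beta eta_le
  eta_alpha eta_beta_lam eta_Lf2 eta_Lf eta_z drift
  (x := fun i => x k i w) (xh := fun i => a k i w + qh k i w)
  (v := fun i => v k i w) (Lxh := dirL k w) (h := direction k w)
  erefl erefl (run_v_sum k w).
have lyapE : lyap k.+1 w =
    lyapunov Q lam f fstar alpha beta (fun i => x k i w - eta *: direction k w i)
      (fun i => v k i w + (eta * beta) *: dirL k w i).
  rewrite /lyap; congr (lyapunov _ _ _ _ _ _ _ _); apply/funext => i.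
    exact: run_xE.
  by rewrite (run_v (run w)) dirLE.
rewrite -lyapE -/(lyap k w) -/(gain k w) in step.
have gapE : gap k.+1 w <= (1 + s / 2) * residual k w
    + (1 + 2 * z) * eta ^+ 2 * nsq (direction k w).
  have -> : gap k.+1 w = nsq (fun i =>
      (x k i w - a k i w - psi *: q k i w) - eta *: direction k w i).
    rewrite /gap; congr nsq; apply/funext => i.
    rewrite run_xE (run_a (run w)); move: (direction k w i) => S.
    by apply/rowP => j; rewrite !mxE; ring.
  have s2 : 0 < s / 2 by rewrite divr_gt0.
  apply: le_trans (nsq_young _ _ s2) _; rewrite nsqZ lerD2l.
  by rewrite /z le_eqVlt; apply/orP; left; apply/eqP; field; exact: lt0r_neq0.
have errE : nsq (fun i => x k i w - (a k i w + qh k i w)) <=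
    2 * feedback k.+1 w + 2 * sigma ^+ 2 * feedback k w.
  have -> : nsq (fun i => x k i w - (a k i w + qh k i w)) =
      nsq (fun i => e k.+1 i w - sigma *: e k i w).
    congr nsq; apply/funext => i; rewrite (run_e (run w)).
    by apply/rowP => j; rewrite !mxE; ring.
  apply: le_trans (nsq_young _ _ ltr01) _.
  by rewrite nsqZ invr1 -/(feedback k.+1 w) -/(feedback k w); lra.
have c0 : 0 <= c.
  have al0 : 0 < alpha := lt_le_trans beta_gt0 beta_le.
  by rewrite !addr_ge0 ?divr_ge0 ?mulr_ge0 ?(ltW al0) ?(ltW beta_gt0).
have ec0 : 0 <= eta * c by rewrite mulr_ge0 // ltW.
have errE' := ler_wpM2l ec0 errE.
rewrite -/c in step.
exact: (potential_step_arith tau0 step gapE errE').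
Qed.

Let mrun := run_adapted C_comp Lf_gt0 f_smooth run.

Lemma run_vmeasurable k i : [/\ vmeasurable (a k i), vmeasurable (x k i),
  vmeasurable (v k i), vmeasurable (e k i) & vmeasurable (q k i)].
Proof.
have [[ma _ mx mv me] [mq _]] := mrun k i.
by split; [exact: (adapted_vmeasurable seeds ma)|exact: (adapted_vmeasurable seeds mx)|
  exact: (adapted_vmeasurable seeds mv)|exact: (adapted_vmeasurable seeds me)|
  exact: (adapted_vmeasurable seeds mq)].
Qed.

Lemma nnmeasurable_sq (g : Omega -> 'rV[R]_d) :
  vmeasurable g -> nnmeasurable (fun w => enorm (g w) ^+ 2).
Proof.
by move=> mg; split=> [|w]; [exact: measurable_enorm_sq|exact: sqr_ge0].
Qed.

Lemma nnmeasurable_nsq (g : 'I_n -> Omega -> 'rV[R]_d) :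
  (forall i, vmeasurable (g i)) -> nnmeasurable (fun w => nsq (fun i => g i w)).
Proof.
by move=> mg; apply: nnmeasurable_sum => i; exact: nnmeasurable_sq.
Qed.

Lemma nnmeasurable_gap k : nnmeasurable (gap k).
Proof.
apply: nnmeasurable_nsq => i; have [ma mx _ _ _] := run_vmeasurable k i.
exact: vmeasurableB.
Qed.

Lemma nnmeasurable_residual k : nnmeasurable (residual k).
Proof.
apply: nnmeasurable_nsq => i; have [ma mx _ _ mq] := run_vmeasurable k i.
by apply: vmeasurableB; [exact: vmeasurableB|exact: vmeasurableZ].
Qed.

Lemma nnmeasurable_feedback k : nnmeasurable (feedback k).
Proof.
by apply: nnmeasurable_nsq => i; have [_ _ _ me _] := run_vmeasurable k i.
Qed.

Lemma vmeasurable_mean_x k : vmeasurable (fun w => mean (fun i => x k i w)).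
Proof.
by apply: vmeasurable_mean => i; have [_ mx _ _ _] := run_vmeasurable k i.
Qed.

Lemma measurable_mode (g : 'I_n -> Omega -> 'rV[R]_d) l j :
  (forall i, vmeasurable (g i)) ->
  measurable_fun setT (fun w => mode Q (fun i => g i w) l j).
Proof.
move=> mg; apply: measurable_sum => i; apply: measurable_funM => //.
exact: measurable_coord_comp.
Qed.

Lemma avg_continuous : continuous (avg f).
Proof.
have -> : avg f = n%:R^-1 \*: (\sum_i f i).
  by apply/funext => y; rewrite /avg /= fct_sumE.
move=> y; apply: differentiable_continuous; apply: differentiableZ.
by apply: differentiable_sum.
Qed.

Lemma nnmeasurable_lyap k : nnmeasurable (lyap k).
Proof.
split=> [|w]; last first.
  rewrite addr_ge0 //.
    exact: (modes_energy_ge0 _ rho2_gt0 lamP beta_gt0 beta_le alpha_ge).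
  by rewrite mulr_ge0 // subr_ge0.
have mx i : vmeasurable (x k i) by have [_ mx _ _ _] := run_vmeasurable k i.
have mw i : vmeasurable (fun w =>
    v k i w + beta^-1 *: grad (f i) (mean (fun i => x k i w))).
  have [_ _ mv _ _] := run_vmeasurable k i.
  apply: vmeasurableD => //; apply: vmeasurableZ.
  apply: (lipschitz_comp_measurable Lf_gt0 _ (vmeasurable_mean_x k)).
  exact: f_smooth.
apply: measurable_funD.
  apply: measurable_sum => l; apply: measurable_sum => j.
  have m1 := measurable_mode l j mx; have m2 := measurable_mode l j mw.
  apply: measurable_funD; last by apply: measurable_funM => //; exact: measurable_funM.
  apply: measurable_funD.
    by apply: measurable_funM => //; exact: measurable_funX.
  apply: measurable_funM => //; apply: measurable_funX.
  exact: measurable_funM.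
apply: measurable_funM => //; apply: measurable_funB => //.
exact: (continuous_comp_measurable avg_continuous (vmeasurable_mean_x k)).
Qed.

Lemma nnmeasurable_centered k :
  nnmeasurable (fun w => nsq (centered (fun i => x k i w))).
Proof.
apply: (@nnmeasurable_nsq (fun i w => x k i w - mean (fun i => x k i w))) => i.
have [_ mx _ _ _] := run_vmeasurable k i.
by apply: vmeasurableB => //; exact: vmeasurable_mean_x.
Qed.

Lemma nnmeasurable_grad_mean k : nnmeasurable (fun w =>
  enorm (grad (avg f) (mean (fun i => x k i w))) ^+ 2).
Proof.
apply: nnmeasurable_sq.
rewrite /vmeasurable; under eq_fun do rewrite grad_avg //.
apply: vmeasurable_mean => i.
apply: (lipschitz_comp_measurable Lf_gt0 _ (vmeasurable_mean_x k)).
exact: f_smooth.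
Qed.

Lemma nnmeasurable_gain k : nnmeasurable (gain k).
Proof.
apply: nnmeasurableD; apply: nnmeasurableZ.
- by rewrite mulr_ge0 // ltW.
- exact: nnmeasurable_centered.
- exact: divr_ge0.
- exact: nnmeasurable_grad_mean.
Qed.

Lemma mass_residual k : (mass P (residual k) <= (1 - s)%:E * mass P (gap k))%E.
Proof.
apply: (@mass_sum_le _ _ _ P _ _
  (fun i w => enorm (x k i w - a k i w) ^+ 2)
  (fun i w => enorm (x k i w - a k i w - psi *: q k i w) ^+ 2)) => i;
  have [ma mx _ _ mq] := run_vmeasurable k i.
- by apply: nnmeasurable_sq; exact: vmeasurableB.
- apply: nnmeasurable_sq; apply: vmeasurableB; first exact: vmeasurableB.
  exact: vmeasurableZ.
(* As [psi * r <= 1], the residual is a convex combination of the gap and of minus the error of the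
   rescaled compressor; convexity of the square gives this factor. *)
have -> : 1 - s = (1 - psi * r) + psi * r * (1 - phi) by rewrite /s; ring.
apply: (@mass_le_combination _ _ _ P _ _ _ _
  (fun w => enorm (r^-1 *: q k i w - (x k i w - a k i w)) ^+ 2)).
- by apply: nnmeasurable_sq; exact: vmeasurableB.
- apply: nnmeasurable_sq; apply: vmeasurableB; first exact: vmeasurableZ.
  exact: vmeasurableB.
- apply: nnmeasurable_sq; apply: vmeasurableB; first exact: vmeasurableB.
  exact: vmeasurableZ.
- by rewrite subr_ge0.
- exact: ltW.
- by rewrite subr_ge0.
- move=> w; rewrite -(enormN_sq (r^-1 *: _ - _)).
  have -> : x k i w - a k i w - psi *: q k i w =
      (1 - psi * r) *: (x k i w - a k i w)
      + (psi * r) *: - (r^-1 *: q k i w - (x k i w - a k i w)).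
    by apply/rowP => j; rewrite !mxE; field; exact: lt0r_neq0.
  by apply: enorm_convex; rewrite (ltW psir_gt0).
have [[ma' _ mx' _ _] _] := mrun k i.
have := @compress_integral_le _ _ _ _ _ mu C phi r _ _ P xi xih phi_le1 C_comp
  seeds k false i (fun w => x k i w - a k i w) (vmeasurableB mx' ma').
by rewrite /mass; under eq_integral do rewrite -(qE run).
Qed.

Lemma mass_feedback k : (mass P (feedback k.+1) <=
  (cr0 phi r * r1 * sigma ^+ 2)%:E * mass P (feedback k)
  + (cr0 phi r * cr2 r1)%:E * mass P (gap k))%E.
Proof.
pose zz i w := sigma *: e k i w + x k i w - a k i w.
have mzz i : vmeasurable (zz i).
  have [ma mx _ me _] := run_vmeasurable k i; apply: vmeasurableB => //.
  by apply: vmeasurableD => //; exact: vmeasurableZ.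
have mqh i : vmeasurable (qh k i).
  have [_ [_ mqh]] := mrun k i; exact: (adapted_vmeasurable seeds mqh).
have r00 : 0 <= cr0 phi r := cr0_ge0 r phi_le1.
have r20 := cr2_gt0 r1_gt1; have r10 : 0 < r1 by apply: lt_trans r1_gt1.
have comp : (mass P (feedback k.+1) <=
    (cr0 phi r)%:E * mass P (fun w => nsq (fun i => zz i w)))%E.
  apply: (@mass_sum_le _ _ _ P _ _ (fun i w => enorm (zz i w) ^+ 2)
    (fun i w => enorm (e k.+1 i w) ^+ 2)) => i.
  - exact: nnmeasurable_sq.
  - by have [_ _ _ me _] := run_vmeasurable k.+1 i; exact: nnmeasurable_sq.
  (* Origin of [cr0]: the new memory is [1 - r] times the compressor input minus [r] times the
     rescaled error, and Young's inequality with weight 1 doubles both squares. *)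
  have -> : cr0 phi r = 2 * (1 - r) ^+ 2 + 2 * r ^+ 2 * (1 - phi).
    by rewrite /cr0 addrC.
  apply: (@mass_le_combination _ _ _ P _ _ _ _
    (fun w => enorm (r^-1 *: qh k i w - zz i w) ^+ 2)).
  - exact: nnmeasurable_sq.
  - apply: nnmeasurable_sq; apply: vmeasurableB => //.
    exact: (vmeasurableZ _ (mqh i)).
  - by have [_ _ _ me _] := run_vmeasurable k.+1 i; exact: nnmeasurable_sq.
  - by rewrite mulr_ge0 ?sqr_ge0.
  - by rewrite mulr_ge0 ?sqr_ge0.
  - by rewrite subr_ge0.
  - move=> w; have -> : e k.+1 i w =
        (1 - r) *: zz i w + (- r) *: (r^-1 *: qh k i w - zz i w).
      rewrite (run_e (run w)) /zz; apply/rowP => j; rewrite !mxE; field.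
      exact: lt0r_neq0.
    apply: le_trans (enorm_young _ _ ltr01) _.
    by rewrite !enormZ_sq invr1 sqrrN !mulrA.
  have [[ma' _ mx' _ me'] _] := mrun k i.
  have mzz' := vmeasurableB (vmeasurableD (vmeasurableZ sigma me') mx') ma'.
  have := @compress_integral_le _ _ _ _ _ mu C phi r _ _ P xi xih phi_le1 C_comp
    seeds k (k != 0%N) i (zz i) mzz'.
  by rewrite /mass; under eq_integral do rewrite -(qhE run).
apply: le_trans comp _.
have mfb := nnmeasurable_feedback k; have mgap := nnmeasurable_gap k.
have R1 : 0 <= r1 * sigma ^+ 2 by rewrite mulr_ge0 ?sqr_ge0 // ltW.
have mfb' := nnmeasurableZ R1 mfb; have mgap' := nnmeasurableZ (ltW r20) mgap.
have mnzz : nnmeasurable (fun w => nsq (fun i => zz i w)).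
  exact: nnmeasurable_nsq.
have : (mass P (fun w => nsq (fun i => zz i w)) <=
    (r1 * sigma ^+ 2)%:E * mass P (feedback k)
    + (cr2 r1)%:E * mass P (gap k))%E.
  rewrite -!massZ // -?massD //; last exact: ltW.
  apply: le_mass => // [|w]; first exact: nnmeasurableD.
  (* Young's inequality with weight [r1 - 1] has the factors [r1] and [1 + (r1 - 1)^-1 = cr2 r1]. *)
  have r11 : 0 < r1 - 1 by rewrite subr_gt0.
  have -> : nsq (fun i => zz i w) = nsq (fun i =>
      sigma *: e k i w - - (x k i w - a k i w)).
    by congr nsq; apply/funext => i; rewrite /zz opprK addrA.
  apply: le_trans (nsq_young _ _ r11) _; rewrite nsqZ.
  have -> : nsq (fun i => - (x k i w - a k i w)) = gap k w.
    by apply: eq_bigr => i _; rewrite enormN_sq.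
  rewrite -/(feedback k w) /cr2 le_eqVlt; apply/orP; left; apply/eqP.
  by field; rewrite lt0r_neq0.
move=> /(lee_wpmul2l (_ : (0 <= (cr0 phi r)%:E)%E)) H.
apply: le_trans (H _) _; first by rewrite lee_fin.
rewrite ge0_muleDr ?mule_ge0 ?mass_ge0 ?lee_fin // ?(ltW r20) //.
by rewrite !muleA -!EFinM !mulrA.
Qed.

Definition potential k w := lyap k w + gap k w + tau0 * feedback k w.

Lemma nnmeasurable_potential k : nnmeasurable (potential k).
Proof.
apply: nnmeasurableD; last first.
  by apply: nnmeasurableZ; [exact: ltW|exact: nnmeasurable_feedback].
by apply: nnmeasurableD; [exact: nnmeasurable_lyap|exact: nnmeasurable_gap].
Qed.

Lemma mass_potential_step k :
  (mass P (potential k.+1) + eta%:E * mass P (gain k) <= mass P (potential k))%E.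
Proof.
have etag : nnmeasurable (fun w => eta * gain k w).
  by apply: nnmeasurableZ; [exact: ltW|exact: nnmeasurable_gain].
have mpot := nnmeasurable_potential k.+1.
rewrite -massZ ?(ltW eta_gt0) //; last exact: nnmeasurable_gain.
rewrite -massD //.
have al0 : 0 < alpha := lt_le_trans beta_gt0 beta_le.
have c0 : 0 <= c.
  by rewrite !addr_ge0 ?divr_ge0 ?mulr_ge0 ?(ltW al0) ?(ltW beta_gt0).
have ec0 : 0 <= 2 * eta * c by rewrite mulr_ge0 // mulr_ge0 // ltW.
have r00 : 0 <= cr0 phi r := cr0_ge0 r phi_le1.
have r20 := ltW (cr2_gt0 r1_gt1); have r10 : 0 <= r1.
  by apply: le_trans (ltW r1_gt1).
have s1 : s <= 1 by rewrite -(invrK s) invf_le1 // invr_gt0.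
apply: (@expected_descent _ _ _ P (1 + s / 2) (tau0 + 2 * eta * c)
  (2 * eta * c * sigma ^+ 2) (1 - s) (cr0 phi r * r1 * sigma ^+ 2)
  (cr0 phi r * cr2 r1) tau0 _ _ _ (residual k) (feedback k.+1)).
- exact: nnmeasurable_lyap.
- exact: nnmeasurable_gap.
- exact: nnmeasurable_feedback.
- exact: nnmeasurable_residual.
- exact: nnmeasurable_feedback.
- exact: nnmeasurableD.
- by rewrite addr_ge0 // divr_ge0 // ltW.
- by rewrite addr_ge0 // ltW.
- by rewrite mulr_ge0 ?sqr_ge0.
- by rewrite subr_ge0.
- by rewrite mulr_ge0 ?sqr_ge0 // mulr_ge0.
- exact: mulr_ge0.
- exact: tau0_gt0.
- exact: potential_step.
- exact: mass_residual.
- exact: mass_feedback.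
(* Origin of [eps7]: the net contraction of the gap, after the Young factor [1 + s / 2]. *)
- have : (1 + s / 2) * (1 - s) = 1 - eps7 phi r psi.
    by rewrite /eps7 -/s; field.
  by move=> ->; rewrite addrAC -addrA gerDl subr_le0.
- apply: le_trans tau2_cond; rewrite le_eqVlt; apply/orP; left; apply/eqP; ring.
Qed.

Lemma mass_potential_telescope T :
  (mass P (potential T)
   + eta%:E * \sum_(0 <= k < T) mass P (gain k) <= mass P (potential 0))%E.
Proof.
elim: T => [|T IH]; first by rewrite big_geq // mule0 adde0.
have g0 k : (0 <= mass P (gain k))%E by apply: mass_ge0; exact: nnmeasurable_gain.
rewrite big_nat_recr //= ge0_muleDr ?sume_ge0 // addeCA addeC.
apply: le_trans IH; rewrite leeD2r //.
exact: mass_potential_step.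
Qed.

Lemma potential0_cst : exists2 V0, 0 <= V0 & forall w, potential 0 w = V0.
Proof.
pose V0 := lyapunov Q lam f fstar alpha beta x0 (fun=> 0) + nsq x0.
have V0E w : potential 0 w = V0.
  rewrite /potential /lyap /gap /feedback.
  have -> : nsq (fun i => e 0%N i w) = 0.
    rewrite /nsq big1 // => i _; rewrite (run_e0 (run w)) enorm_sqE big1 //.
    by move=> j _; rewrite mxE expr0n.
  have -> : (fun i => x 0%N i w - a 0%N i w) = x0.
    by apply/funext => i; rewrite (run_x0 (run w)) (run_a0 (run w)) subr0.
  have -> : (fun i => x 0%N i w) = x0.
    by apply/funext => i; exact: (run_x0 (run w)).
  have -> : (fun i => v 0%N i w) = (fun=> 0).
    by apply/funext => i; exact: (run_v0 (run w)).
  by rewrite mulr0 addr0.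
have [_ p0] := nnmeasurable_potential 0.
(* A sample point is needed to carry nonnegativity from the potential over to its constant value. *)
have [w _] : exists w : Omega, True by exists point.
by exists V0 => //; rewrite -(V0E w).
Qed.

Lemma algorithm_bounded : exists M : R, forall T : nat,
  (\sum_(0 <= k < T.+1) \sum_(i < n)
     'E_P[fun w => (enorm (x k i w - mean (fun i => x k i w)) ^+ 2
                    + enorm (grad (avg f) (mean (fun i => x k i w))) ^+ 2)%R]
     <= M%:E)%E /\
  ('E_P[fun w => (avg f (mean (fun i => x T i w)) - fstar)%R] <= M%:E)%E.
Proof.
have [V0 V00 V0E] := potential0_cst.
have mV0 : mass P (potential 0) = V0%:E by rewrite (funext V0E) mass_cst.
have g0 k : (0 <= mass P (gain k))%E by apply: mass_ge0; exact: nnmeasurable_gain.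
have p0 k : (0 <= mass P (potential k))%E.
  by apply: mass_ge0; exact: nnmeasurable_potential.
(* The two summands invert the weights [9 / 8 * beta] and [1 / 2] in [gain], so that [K] times the
   gain dominates both errors. *)
pose K := 8 / (9 * beta) + 2.
have K0 : 0 <= K by rewrite addr_ge0 // divr_ge0 // mulr_ge0 // ltW.
exists (Num.max (K * (V0 / eta)) V0) => T; split.
  have step k : (\sum_(i < n)
     'E_P[fun w => (enorm (x k i w - mean (fun i => x k i w)) ^+ 2
                    + enorm (grad (avg f) (mean (fun i => x k i w))) ^+ 2)%R]
      <= K%:E * mass P (gain k))%E.
    have mc i : nnmeasurable (fun w => enorm (x k i w - mean (fun i => x k i w)) ^+ 2).
      have [_ mx _ _ _] := run_vmeasurable k i; apply: nnmeasurable_sq.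
      by apply: vmeasurableB => //; exact: vmeasurable_mean_x.
    have mg := nnmeasurable_grad_mean k.
    have mt i := nnmeasurableD (mc i) mg.
    under eq_bigr do rewrite unlock -/(mass P _).
    rewrite -mass_sum // -massZ //; last exact: nnmeasurable_gain.
    apply: le_mass => [||w].
    - exact: nnmeasurable_sum.
    - by apply: nnmeasurableZ => //; exact: nnmeasurable_gain.
    rewrite big_split /= sumr_const card_ord -/(nsq (centered _)) -mulr_natl.
    rewrite /gain /K; set X := nsq _; set G := n%:R * _.
    have X0 : 0 <= X by exact: nsq_ge0.
    have G0 : 0 <= G by rewrite mulr_ge0 ?sqr_ge0.
    have -> : n%:R / 2 * enorm (grad (avg f) (mean (fun i => x k i w))) ^+ 2 = G / 2.
      by rewrite /G; field.
    rewrite -subr_ge0.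
    have -> : (8 / (9 * beta) + 2) * (9 / 8 * beta * X + G / 2) - (X + G) =
        9 / 4 * beta * X + 4 / (9 * beta) * G by field; rewrite lt0r_neq0.
    by do ?[assumption | exact: ltW | apply: addr_ge0 | apply: mulr_ge0 |
      rewrite invr_ge0].
  apply: (@le_trans _ _ (\sum_(0 <= k < T.+1) (K%:E * mass P (gain k)))%E).
    by apply: lee_sum => k _; exact: step.
  rewrite -ge0_sume_distrr //.
  (* The sum includes [k = T], so the telescoping runs to [T.+1], and the potential there is dropped
     as nonnegative. *)
  have tel : (eta%:E * \sum_(0 <= k < T.+1) mass P (gain k) <= V0%:E)%E.
    by rewrite -mV0; apply: le_trans (mass_potential_telescope T.+1); rewrite leeDr.
  have sum_le : (\sum_(0 <= k < T.+1) mass P (gain k) <= (V0 / eta)%:E)%E.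
    by rewrite mulrC EFinM lee_pdivlMl.
  apply: (@le_trans _ _ (K * (V0 / eta))%:E).
    by rewrite EFinM lee_wpmul2l // lee_fin.
  by rewrite lee_fin le_max lexx.
have fT : nnmeasurable (fun w => avg f (mean (fun i => x T i w)) - fstar).
  split=> [|w]; last by rewrite subr_ge0.
  apply: measurable_funB => //.
  exact: (continuous_comp_measurable avg_continuous (vmeasurable_mean_x T)).
rewrite unlock -/(mass P _).
(* The optimality gap occurs in the potential with the factor [n], at least 1, beside nonnegative
   terms. *)
apply: (@le_trans _ _ (mass P (potential T))).
  apply: le_mass => // [|w]; first exact: nnmeasurable_potential.
  have [_ gap0] := nnmeasurable_gap T; have [_ fb0] := nnmeasurable_feedback T.
  rewrite /potential -addrA ler_wpDr //.
    by rewrite addr_ge0 // mulr_ge0 // ltW.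
  rewrite /lyap /lyapunov ler_wpDl //.
    exact: (modes_energy_ge0 _ rho2_gt0 lamP beta_gt0 beta_le alpha_ge).
  by rewrite ler_peMl ?subr_ge0 // ler1n.
apply: (@le_trans _ _ V0%:E); last by rewrite lee_fin le_max lexx orbT.
rewrite -mV0; apply: le_trans (mass_potential_telescope T); rewrite leeDl //.
by rewrite mule_ge0 ?lee_fin ?(ltW eta_gt0) // sume_ge0.
Qed.

End Convergence.


Theorem theorem3 (R : realType) (n d : nat) (n_ge2 : (2 <= n)%N)
  (* communication graph *)
  (A L : 'M[R]_n) (rho rho2 : R)
  (graphA : connected_weighted_graph A)
  (L_def : L = laplacian A)
  (rho_def : rho = spectral_radius L)
  (rho2_def : rho2 = smallest_pos_eigenvalue L)
  (* cost functions *)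
  (f : 'I_n -> 'rV[R]_d -> R) (Lf fstar : R)
  (f_diff : forall i x, differentiable (f i) x)
  (Lf_gt0 : 0 < Lf)
  (f_smooth : forall i x y,
     enorm (grad (f i) x - grad (f i) y) <= Lf * enorm (x - y))
  (fstar_min : is_minimum (avg f) fstar)
  (* compressor *)
  (dW : measure_display) (W : measurableType dW) (mu : probability W R)
  (C : W -> 'rV[R]_d -> 'rV[R]_d) (phi r : R)
  (phi_range : 0 < phi <= 1) (r_gt0 : 0 < r)
  (C_comp : compressor mu C phi r)
  (* parameters *)
  (alpha beta eta psi sigma r1 tau0 kappa1 kappa4 : R)
  (r1_gt1 : 1 < r1)
  (kappa4_gt0 : 0 < kappa4)
  (kappa1_ge : Num.max ((9 + kappa4) / (2 * rho2)) 1 <= kappa1)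
  (tau0_gt0 : 0 < tau0) (tau0_lt : (tau0%:E < tau0_bound phi r r1 psi)%E)
  (alpha_def : alpha = kappa1 * beta)
  (beta_gt : kappa2 rho2 Lf kappa1 kappa4 < beta)
  (psi_range : 0 < psi <= r^-1)
  (sigma_gt0 : 0 < sigma) (sigma_lt : (sigma%:E < kappa0 phi r r1)%E)
  (eta_gt0 : 0 < eta)
  (eta_lt : (eta%:E < check_kappa3 rho rho2 Lf phi r r1 tau0
                        alpha beta psi sigma)%E)
  (* the random iterates *)
  (dO : measure_display) (Omega : measurableType dO) (P : probability Omega R)
  (xi xih : nat -> 'I_n -> Omega -> W)
  (seeds : fresh_seeds P mu xi xih)
  (x0 : 'I_n -> 'rV[R]_d)
  (a b x v q e qh : nat -> 'I_n -> Omega -> 'rV[R]_d)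
  (run : forall w : Omega,
     error_feedback_run C L f alpha beta eta psi sigma x0
       (fun k i => xi k i w) (fun k i => xih k i w)
       (fun k i => a k i w) (fun k i => b k i w) (fun k i => x k i w)
       (fun k i => v k i w) (fun k i => q k i w) (fun k i => e k i w)
       (fun k i => qh k i w)) :
  let xbar k w := mean (fun i => x k i w) in
  exists M : R, forall T : nat,
    (\sum_(0 <= k < T.+1) \sum_(i < n)
       'E_P[fun w => (enorm (x k i w - xbar k w) ^+ 2
                      + enorm (grad (avg f) (xbar k w)) ^+ 2)%R] <= M%:E)%E /\
    ('E_P[fun w => (avg f (xbar T w) - fstar)%R] <= M%:E)%E.
Proof.
have [m [Q [lam [rho2_gt0 rho2_le lamP eig iso]]]] :=
  laplacian_spectral n_ge2 graphA.
rewrite -L_def -?rho_def -?rho2_def in rho2_gt0 rho2_le lamP eig iso.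
have /andP[phi0 phi1] := phi_range; have /andP[psi0 psi_le] := psi_range.
have n_gt0 : (0 < n)%N by apply: leq_trans n_ge2.
have pr0 : 0 < psi * r by rewrite mulr_gt0.
have pr1 : psi * r <= 1 by rewrite -ler_pdivlMr // div1r.
have s0 : 0 < phi * psi * r by rewrite -mulrA mulr_gt0.
have s1 : phi * psi * r <= 1.
  by rewrite -mulrA; apply: mulr_ile1 => //; exact: ltW.
have rho0 : 0 <= rho by apply: le_trans (ltW rho2_gt0) rho2_le.
move: eta_lt; rewrite /check_kappa3 !lt_min => /and5P[].
rewrite !lte_fin => eta1 eta3 _ etat1 etat2.
have col_sum j : \sum_i L i j = 0.
  rewrite -[RHS](laplacian_row_sum A j) L_def.
  by apply: eq_bigr => i _; rewrite -[in LHS](laplacian_sym graphA) mxE.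
have b0 := beta_gt0 rho2_gt0 beta_gt.
have ab := alpha_ge_beta rho2_gt0 kappa1_ge alpha_def beta_gt.
have a0 : 0 <= alpha by apply: le_trans (ltW b0) ab.
have z1 := invs_ge1 s0 s1.
have al_ge :=
  alpha_rho2_ge_beta rho2_gt0 kappa4_gt0 kappa1_ge alpha_def beta_gt.
have eb := eta_beta rho2_gt0 rho2_le s0 s1 kappa4_gt0 kappa1_ge alpha_def
  beta_gt eta_gt0 eta1.
have el := eta_le rho2_gt0 rho2_le s0 s1 kappa1_ge alpha_def beta_gt
  eta_gt0 eta1.
have ea := eta_alpha_rho rho2_gt0 rho2_le s0 s1 kappa1_ge alpha_def beta_gt
  eta_gt0 eta1.
have ebl l := eta_beta_lam rho2_gt0 rho2_le s0 s1 kappa4_gt0 kappa1_ge alpha_def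
  beta_gt eta_gt0 eta1 eta3 (lamP l).
have e1 := eta_eps1 s0 s1 eta_gt0 eta1.
have eL2 : eta * (8 * (phi * psi * r)^-1 + 7) * Lf ^+ 2 <=
    alpha / 2 * rho2 - 1 / 4 * (9 * beta + 4 + 5 * Lf ^+ 2).
  apply: le_trans e1; rewrite ler_wpM2l ?lerDr ?sqr_ge0 //.
  by rewrite mulr_ge0 ?(ltW eta_gt0) // addr_ge0 // mulr_ge0 // invr_ge0 ltW.
have eL := eta_Lf rho2_gt0 rho2_le Lf_gt0 s0 s1 kappa1_ge alpha_def beta_gt
  eta_gt0 eta1.
have ez := eta_invs rho2_gt0 rho2_le s0 s1 kappa1_ge alpha_def beta_gt
  eta_gt0 eta1.
have dr := dual_drift_coef rho2_gt0 alpha_def beta_gt.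
have t1 := tau1_condition rho0 s0 phi1 r1_gt1 a0 (ltW b0) (ltW eta_gt0) etat1.
have t2 := tau2_condition rho0 phi1 r1_gt1 a0 (ltW b0) (ltW eta_gt0)
  sigma_gt0 etat2.
have [_ fmin] := fstar_min.
exact: (algorithm_bounded phi1 C_comp Lf_gt0 f_smooth seeds run n_gt0 f_diff
  fmin
  col_sum rho2_gt0 lamP eig iso s0 pr0 pr1 r_gt0 eta_gt0 z1 b0 ab al_ge rho0
  eb el ea ebl eL2 eL ez dr r1_gt1 tau0_gt0 t1 t2).
Qed.
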